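(* Let $X_1,\dots,X_n$ and $V_1,\dots,V_n$ be Banach spaces, and for $1\le i\le n$ let $A_i$ generate a cosine operator function with associated phase space $V_i\times X_i$ (i.e. the initial value problem associated with the uncoupled system $\ddot u_i(t)=A_iu_i(t)$, $t\in\mathbb{R}$, $i=1,\dots,n$, is well-posed). Consider linear operators $B^h_k$ and $C^k_h$, $1\le h<k\le n$, such that - $B^h_k\in\mathcal{L}([D(A_k)],V_h)$ or $B^h_k\in\mathcal{L}(V_k,X_h)$, and - $C^k_h\in\mathcal{L}([D(A_h)],V_k)$ or $C^k_h\in\mathcal{L}(V_h,X_k)$. Then the initial value problem associated with the coupled system $$\ddot u_i(t)=A_iu_i(t)+\sum_{k=i+1}^{n}B^i_k u_k(t)+\sum_{h=1}^{i-1}C^i_h u_h(t),\qquad t\in\mathbb{R},\quad i=1,\dots,n,$$ is governed by a cosine operator function with associated phase space $\left(\prod_{i=1}^n V_i\right)\times\left(\prod_{i=1}^n X_i\right)$, and in particular it is well-posed.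
   Context: For a closed operator $T$ on a Banach space, $[D(T)]$ denotes the domain of $T$ with the graph norm. $\mathcal{L}(E,F)$ denotes the bounded linear operators from $E$ to $F$. The symbol $\hookrightarrow$ denotes a continuous embedding. A cosine operator function (COF) on a Banach space $E$ is a strongly continuous family $(C(t))_{t\in\mathbb{R}}$ of bounded linear operators on $E$ with $C(0)=I$ and $C(t+s)+C(t-s)=2C(t)C(s)$ for all $s,t\in\mathbb{R}$. Its generator is $Tx=\frac{d^2}{dt^2}C(t)x|_{t=0}$ on the set of $x$ for which $t\mapsto C(t)x$ is $C^2$. A closed operator $T$ on $E$ generates a COF on $E$ if and only if there is a Banach space $F$ with $[D(T)]\hookrightarrow F\hookrightarrow E$ such that $\begin{pmatrix}0&I_F\\ T&0\end{pmatrix}$ with domain $D(T)\times F$ generates a $C_0$-semigroup on $F\times E$. Such an $F$ is unique; it is called the Kisyński space, and $F\times E$ is called the associated phase space. ''$T$ generates a COF with associated phase space $F\times E$'' means that $T$ generates a COF on $E$ and its Kisyński space is $F$. The coupled system is written as $\ddot{\mathfrak u}(t)=\mathcal{A}\mathfrak{u}(t)$ on $\prod_{i=1}^nX_i$, where $\mathfrak u=(u_1,\dots,u_n)^{\top}$ and $\mathcal{A}$ is the $n\times n$ operator matrix with diagonal entries $A_i$, entries $B^h_k$ in position $(h,k)$ and $C^k_h$ in position $(k,h)$ for $h<k$, and domain $D(\mathcal{A})=\prod_{i=1}^nD(A_i)$. ''The initial value problem is governed by a COF with associated phase space $\mathbf{P}$'' means that $\mathcal{A}$ generates a COF with associated phase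 space $\mathbf{P}$. Well-posedness of such a second order initial value problem means that the governing operator ($\mathcal{A}$, respectively each $A_i$) generates a COF. *)

(* Defs.v *)
From Stdlib Require Import Reals Lra FunctionalExtensionality.
From Coquelicot Require Import Coquelicot.
From mathcomp Require Import ssreflect ssrfun ssrbool eqtype ssrnat seq fintype bigop.

Set Implicit Arguments.
Unset Strict Implicit.
Unset Printing Implicit Defensive.

Local Open Scope R_scope.

(* Banach spaces are real or complex, while the time variable is always real.
   A Banach space over the chosen field is a [CompleteNormedModule], and a
   bounded linear operator is Coquelicot's [is_linear]. *)

Variant scalars := Real | Complex.

Definition field_of (k : scalars) : AbsRing :=
  match k with Real => R_AbsRing | Complex => C_AbsRing end.

Definition of_real (k : scalars) : R -> field_of k :=
  match k with Real => fun r => r | Complex => RtoC end.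

Lemma of_real_one k : of_real k 1 = one.
Proof. by case: k. Qed.

Lemma of_real_plus k r s : of_real k (r + s) = plus (of_real k r) (of_real k s).
Proof. by case: k => //=; apply: RtoC_plus. Qed.

Lemma of_real_mult k r s : of_real k (r * s) = mult (of_real k r) (of_real k s).
Proof. by case: k => //=; apply: RtoC_mult. Qed.

Lemma abs_of_real k r : abs (of_real k r) = Rabs r.
Proof. by case: k => //=; apply: Cmod_R. Qed.

(* Restriction of scalars, needed to differentiate functions of real time. *)
Section Realify.
Variables (k : scalars) (E : NormedModule (field_of k)).

Definition realify_ModuleSpace_mixin :=
  @ModuleSpace.Mixin R_Ring E (fun r x => scal (of_real k r) x)
    (fun r s x => eq_trans (scal_assoc (of_real k r) (of_real k s) x)
       (f_equal (fun c => scal c x) (esym (of_real_mult k r s))))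
    (fun x => eq_trans (f_equal (fun c => scal c x) (of_real_one k)) (scal_one x))
    (fun r => scal_distr_l (of_real k r))
    (fun r s x => eq_trans (f_equal (fun c => scal c x) (of_real_plus k r s))
       (scal_distr_r (of_real k r) (of_real k s) x)).

Definition realify_ModuleSpace : ModuleSpace R_Ring :=
  ModuleSpace.Pack R_Ring E
    (ModuleSpace.Class R_Ring E (AbelianGroup.class E) realify_ModuleSpace_mixin) E.

Definition realify_NormedModuleAux : NormedModuleAux R_AbsRing :=
  NormedModuleAux.Pack R_AbsRing E
    (NormedModuleAux.Class R_AbsRing E
      (ModuleSpace.class R_Ring realify_ModuleSpace) (UniformSpace.class E)) E.

Lemma realify_norm_scal (r : R) (x : E) :
  norm (scal (of_real k r) x) <= Rabs r * norm x.
Proof. by rewrite -(abs_of_real k); apply: norm_scal. Qed.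

Definition realify_NormedModule_mixin :=
  @NormedModule.Mixin R_AbsRing realify_NormedModuleAux (@norm _ E)
    (@norm_factor _ E) (@norm_triangle _ E) realify_norm_scal
    (@norm_compat1 _ E) (@norm_compat2 _ E) (@norm_eq_zero _ E).

Definition realify : NormedModule R_AbsRing :=
  NormedModule.Pack R_AbsRing E
    (NormedModule.Class R_AbsRing E (NormedModuleAux.class R_AbsRing realify_NormedModuleAux)
      realify_NormedModule_mixin) E.

End Realify.

(* The Banach space X_1 x ... x X_n, with the maximum norm. *)
Section FiniteProduct.
Variables (K : AbsRing) (n : nat) (X : 'I_n -> CompleteNormedModule K).

Definition fprod : Type := forall i : 'I_n, X i.

Definition fprod_AbelianMonoid_mixin : AbelianMonoid.mixin_of fprod.
Proof.
refine (@AbelianMonoid.Mixin fprod (fun x y i => plus (x i) (y i)) (fun i => zero) _ _ _).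
- by move=> x y; apply: functional_extensionality_dep => i; apply: plus_comm.
- by move=> x y z; apply: functional_extensionality_dep => i; apply: plus_assoc.
- by move=> x; apply: functional_extensionality_dep => i; apply: plus_zero_r.
Defined.

Canonical fprod_AbelianMonoid := AbelianMonoid.Pack fprod fprod_AbelianMonoid_mixin fprod.

Definition fprod_AbelianGroup_mixin : AbelianGroup.mixin_of fprod_AbelianMonoid.
Proof.
refine (@AbelianGroup.Mixin fprod_AbelianMonoid (fun x i => opp (x i)) _).
by move=> x; apply: functional_extensionality_dep => i; apply: plus_opp_r.
Defined.

Canonical fprod_AbelianGroup :=
  AbelianGroup.Pack fprod (AbelianGroup.Class _ _ fprod_AbelianGroup_mixin) fprod.

Definition fprod_ModuleSpace_mixin : ModuleSpace.mixin_of K fprod_AbelianGroup.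
Proof.
refine (@ModuleSpace.Mixin K fprod_AbelianGroup (fun a x i => scal a (x i)) _ _ _ _).
- by move=> a b x; apply: functional_extensionality_dep => i; apply: scal_assoc.
- by move=> x; apply: functional_extensionality_dep => i; apply: scal_one.
- by move=> a x y; apply: functional_extensionality_dep => i; apply: scal_distr_l.
- by move=> a b x; apply: functional_extensionality_dep => i; apply: scal_distr_r.
Defined.

Canonical fprod_ModuleSpace :=
  ModuleSpace.Pack K fprod (ModuleSpace.Class K fprod _ fprod_ModuleSpace_mixin) fprod.

Definition fprod_UniformSpace_mixin : UniformSpace.mixin_of fprod.
Proof.
refine (@UniformSpace.Mixin fprod (fun i => zero)
  (fun x e y => forall i, ball (x i) e (y i)) _ _ _).
- by move=> x e i; apply: ball_center.
- by move=> x y e xy i; apply: ball_sym.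
- by move=> x y z e1 e2 xy yz i; apply: ball_triangle (xy i) (yz i).
Defined.

Canonical fprod_UniformSpace := UniformSpace.Pack fprod fprod_UniformSpace_mixin fprod.

Canonical fprod_NormedModuleAux :=
  NormedModuleAux.Pack K fprod
    (NormedModuleAux.Class K fprod (ModuleSpace.class K fprod_ModuleSpace)
      fprod_UniformSpace_mixin) fprod.

Definition fprod_norm (x : fprod) : R := \big[Rmax/0]_(i < n) norm (x i).

Lemma bigRmax_le (F : 'I_n -> R) M :
  0 <= M -> (forall i, F i <= M) -> \big[Rmax/0]_(i < n) F i <= M.
Proof.
by move=> M0 FM; elim/big_ind: _ => // x y xM yM; apply: Rmax_lub.
Qed.

Lemma bigRmax_lt (F : 'I_n -> R) M :
  0 < M -> (forall i, F i < M) -> \big[Rmax/0]_(i < n) F i < M.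
Proof.
by move=> M0 FM; elim/big_ind: _ => // x y xM yM; apply: Rmax_lub_lt.
Qed.

Lemma le_bigRmax (F : 'I_n -> R) i : F i <= \big[Rmax/0]_(i < n) F i.
Proof.
have : i \in index_enum 'I_n by apply: mem_index_enum.
elim: (index_enum _) => // j s IHs; rewrite inE big_cons => /orP [/eqP <-|si].
  exact: Rmax_l.
exact: Rle_trans (IHs si) (Rmax_r _ _).
Qed.

Lemma bigRmax_ge0 (F : 'I_n -> R) : (forall i, 0 <= F i) -> 0 <= \big[Rmax/0]_(i < n) F i.
Proof.
move=> F0; elim/big_ind: _ => [|x y x0 _|//]; first exact: Rle_refl.
exact: Rle_trans x0 (Rmax_l _ _).
Qed.

Lemma fprod_norm_ge0 x : 0 <= fprod_norm x.
Proof. by apply: bigRmax_ge0 => i; apply: norm_ge_0. Qed.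

Definition fprod_norm_factor : R := Rmax 1 (\big[Rmax/0]_(i < n) @norm_factor _ (X i)).

Definition fprod_NormedModule_mixin : NormedModule.mixin_of K fprod_NormedModuleAux.
Proof.
refine (@NormedModule.Mixin K fprod_NormedModuleAux fprod_norm fprod_norm_factor _ _ _ _ _).
- move=> x y; apply: bigRmax_le => [|i].
    exact: Rplus_le_le_0_compat (fprod_norm_ge0 x) (fprod_norm_ge0 y).
  apply: Rle_trans (norm_triangle _ _) _.
  exact: Rplus_le_compat (le_bigRmax (fun j => norm (x j)) i)
                         (le_bigRmax (fun j => norm (y j)) i).
- move=> a x; apply: bigRmax_le => [|i].
    exact: Rmult_le_pos (abs_ge_0 a) (fprod_norm_ge0 x).
  apply: Rle_trans (norm_scal _ _) _.
  exact: Rmult_le_compat_l (abs_ge_0 a) (le_bigRmax (fun j => norm (x j)) i).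
- move=> x y e xye; change (forall i, ball (x i) e (y i)) => i; apply: norm_compat1; apply: Rle_lt_trans xye.
  exact: (le_bigRmax (fun j => norm (minus (y j) (x j))) i).
- move=> x y e xy; have e0 := cond_pos e; apply: bigRmax_lt => [|i].
    by apply: Rmult_lt_0_compat => //; apply: Rlt_le_trans (Rmax_l _ _); lra.
  apply: Rlt_le_trans (norm_compat2 _ _ _ (xy i)) _.
  apply: Rmult_le_compat_r; first lra.
  apply: Rle_trans (Rmax_r _ _).
  exact: (le_bigRmax (fun j => @norm_factor _ (X j)) i).
- move=> x x0; apply: functional_extensionality_dep => i; apply: norm_eq_zero.
  apply: Rle_antisym (norm_ge_0 _); rewrite -x0.
  exact: (le_bigRmax (fun j => norm (x j)) i).
Defined.

Canonical fprod_NormedModule :=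
  NormedModule.Pack K fprod
    (NormedModule.Class K fprod (NormedModuleAux.class K fprod_NormedModuleAux)
      fprod_NormedModule_mixin) fprod.

Definition fprod_lim (F : (fprod -> Prop) -> Prop) : fprod :=
  fun i => lim (fun P : X i -> Prop => F (fun x => P (x i))).

Lemma filter_forall_ord (F : (fprod -> Prop) -> Prop) (P : 'I_n -> fprod -> Prop) :
  Filter F -> (forall i, F (P i)) -> F (fun x => forall i, P i x).
Proof.
move=> FF FP.
have : F (fun x => forall i, i \in index_enum 'I_n -> P i x).
  elim: (index_enum _) => [|j s IHs]; first by apply: filter_forall.
  apply: filter_imp (filter_and _ _ (FP j) IHs) => x [Pj Ps] i.
  by rewrite inE => /orP [/eqP ->|/Ps].
by apply: filter_imp => x Px i; apply: Px; apply: mem_index_enum.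
Qed.

Definition fprod_CompleteSpace_mixin : CompleteSpace.mixin_of fprod_UniformSpace.
Proof.
refine (@CompleteSpace.Mixin fprod_UniformSpace fprod_lim _ _).
- move=> F PF cF e.
  apply: (@filter_forall_ord F (fun i x => ball (fprod_lim F i) e (x i))) => i.
  have PFi : ProperFilter (fun P : X i -> Prop => F (fun x => P (x i))).
    exact: (@filtermap_proper_filter fprod (X i) (fun x => x i) F PF).
  apply: (complete_cauchy _ PFi) => e'.
  by have [x Fx] := cF e'; exists (x i); apply: filter_imp Fx => y xy; apply: xy.
- move=> F G FG GF e i.
  by apply: close_lim => P; [apply: FG | apply: GF].
Defined.

Canonical fprod_CompleteNormedModule : CompleteNormedModule K :=
  CompleteNormedModule.Pack K fprod
    (CompleteNormedModule.Class K fprod (NormedModule.class K fprod_NormedModule)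
      fprod_CompleteSpace_mixin) fprod.

End FiniteProduct.

(* An unbounded operator on E with domain [dom]; its values outside [dom] carry
   no information. *)
Record operator (E : Type) := Operator { dom : E -> Prop; op :> E -> E }.

Definition graph (E : Type) (T : operator E) (x y : E) : Prop := dom T x /\ T x = y.

Section Generation.
Variable k : scalars.
Let K := field_of k.

Definition is_C0_semigroup (E : NormedModule K) (S : R -> E -> E) : Prop :=
  (forall t, 0 <= t -> is_linear (S t)) /\
  (forall x, S 0 x = x) /\
  (forall s t x, 0 <= s -> 0 <= t -> S (t + s) x = S t (S s x)) /\
  (forall x t, 0 <= t ->
     filterlim (fun s => S s x) (within (fun s => 0 <= s) (locally t)) (locally (S t x))).

(* The operator with graph G is the generator of some C0-semigroup on E. *)
Definition generates_C0_semigroup (E : NormedModule K) (G : E -> E -> Prop) : Prop :=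
  exists S : R -> E -> E, is_C0_semigroup S /\
    forall x y : E, G x y <->
      filterlim (fun h => scal (of_real k (/ h)) (minus (S h x) x))
        (at_right 0) (locally y).

Definition is_COF (E : CompleteNormedModule K) (C : R -> E -> E) : Prop :=
  (forall t, is_linear (C t)) /\
  (forall x t, continuous (fun s => C s x) t) /\
  (forall x, C 0 x = x) /\
  (forall t s x, plus (C (t + s) x) (C (t - s) x) = scal (of_real k 2) (C t (C s x))).

(* [u] is of class C^2 on R with u''(0) = y. *)
Definition C2_with_second_derivative_at_0 (E : CompleteNormedModule K)
    (u : R -> E) (y : E) : Prop :=
  exists u' u'' : R -> E,
    (forall t, @is_derive R_AbsRing (realify E) u t (u' t)) /\
    (forall t, @is_derive R_AbsRing (realify E) u' t (u'' t)) /\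
    (forall t, continuous u'' t) /\
    u'' 0 = y.

Definition generates_COF (E : CompleteNormedModule K) (T : operator E) : Prop :=
  exists C : R -> E -> E, is_COF C /\
    forall x y : E, graph T x y <-> C2_with_second_derivative_at_0 (fun t => C t x) y.

(* A Banach space F continuously embedded in E is given together with its
   embedding j : F -> E. *)
Definition continuous_embedding (F E : CompleteNormedModule K) (j : F -> E) : Prop :=
  is_linear j /\ injective j.

(* B is in L([D(T)], F), where F is embedded in E' by j: on D(T), B is linear,
   takes values in F, and is bounded from the graph norm to the norm of F. *)
Definition bounded_from_domain (E F E' : CompleteNormedModule K)
    (T : operator E) (j : F -> E') (B : E -> E') : Prop :=
  (forall x y, dom T x -> dom T y -> B (plus x y) = plus (B x) (B y)) /\
  (forall a x, dom T x -> B (scal a x) = scal a (B x)) /\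
  exists M : R, forall x, dom T x ->
    exists v : F, j v = B x /\ norm v <= M * (norm x + norm (T x)).

(* The graph of the operator matrix (0 I_F; T 0) with domain D(T) x F. *)
Definition phase_graph (E F : CompleteNormedModule K) (T : operator E) (j : F -> E)
    (p q : F * E) : Prop :=
  j q.1 = p.2 /\ graph T (j p.1) q.2.

(* F, embedded in E by j, is the Kisynski space of T; the second condition is
   the embedding of [D(T)] in F. *)
Definition is_Kisynski_space (E F : CompleteNormedModule K) (T : operator E)
    (j : F -> E) : Prop :=
  continuous_embedding j /\
  bounded_from_domain T j (fun x => x) /\
  @generates_C0_semigroup (prod_NormedModule K F E) (phase_graph T j).

(* T generates a COF with associated phase space F x E. *)
Definition generates_COF_with_phase_space (E F : CompleteNormedModule K)
    (T : operator E) (j : F -> E) : Prop :=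
  generates_COF T /\ is_Kisynski_space T j.

(* The n x n operator matrix with diagonal entries A_i, entries B^h_k = B h k in
   position (h, k) and C^k_h = C k h in position (k, h) for h < k, and domain
   D(A_1) x ... x D(A_n). *)
Definition coupled_operator (n : nat) (X : 'I_n -> CompleteNormedModule K)
    (A : forall i, operator (X i)) (B C : forall i l : 'I_n, X l -> X i) :
    operator (fprod X) :=
  Operator (fun u => forall i, dom (A i) (u i))
    (fun u i =>
       plus (plus (A i (u i))
                  (\big[plus/zero]_(l < n | (i < l)%N) B i l (u l)))
            (\big[plus/zero]_(h < n | (h < i)%N) C i h (u h))).

Definition fprod_map (n : nat) (V X : 'I_n -> CompleteNormedModule K)
    (j : forall i, V i -> X i) (v : fprod V) : fprod X :=
  fun i => j i (v i).

End Generation.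

(* Main.v *)
(* On the phase space Z = (V_1 x ... x V_n) x (X_1 x ... x X_n) the uncoupled
   system is governed by the product of the given semigroups, with generator G.
   Entries bounded from V_l to X_i give a bounded perturbation of G, handled by
   solving the Volterra equation u(t) = S(t) x + int_0^t S(r) P u(t - r) dr.
   Entries bounded from [D(A_l)] to V_i give an operator B that is bounded on
   [D(G)]; for large l the operator U = I - B (l - G)^-1 is invertible and
   G + B is similar, through U, to a bounded perturbation of G.  Hence the
   coupled phase operator generates a semigroup on Z.

   Conversely, let a phase operator generate a semigroup S.  Conjugation by
   J (v, x) = (v, -x) changes the sign of the generator, so S extends to a group
   with inverse J S(t) J, and C(t) x, the second component of S(t) (0, x), is a
   cosine function.  Its generator is identified through the resolvent, which
   commutes with C(t). *)
Require Import Defs.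
From Stdlib Require Import Reals Lra Lia ClassicalEpsilon FunctionalExtensionality.
From Coquelicot Require Import Coquelicot.
From mathcomp Require Import ssreflect ssrfun ssrbool eqtype ssrnat seq fintype bigop.

Local Open Scope R_scope.

(** The two kinds of entries differ in what controls them. An entry bounded on [V l] acts on the
    phase space as [(v, x) -> (0, P v)] and is bounded for the norm of Z. An entry bounded from
    [[D(A l)]] is controlled only by the graph norm, so [L = B (l - G)^-1] stays bounded as l grows
    but need not become small. Its range rescues the argument: [(0, j v)] always lies in the domain
    of G, with image [(v, 0)], so values in [V i] make B map [[D(G)]] boundedly into itself. On
    graph norms of elements of the domain the resolvent is of size O(1/l); one further application
    of L gains this factor, so L^2 is small, and I - L is inverted through
    [I - L^2 = (I - L) (I + L)]. The resolvent is built from an integral over [[0, 1]], so no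
    improper integral occurs. Only real l is used, which lets the real and the complex case share
    one proof. Cosine function, generator and embedding of the domain are separate parts of the
    conclusion; all three are recovered from the phase semigroup alone. *)

Ltac rlra := intros; lra.
Ltac rnra := intros; nra.

(** * Real scalars and linear combinations *)

Section RealScalars.
Context {k : scalars}.
Local Notation K := (field_of k).

Definition rs {Z : NormedModule K} (r : R) (x : Z) : Z := scal (of_real k r) x.

Lemma of_real_zero : of_real k 0 = zero.
Proof. by case: k. Qed.

Lemma rs_one {Z : NormedModule K} (x : Z) : rs 1 x = x.
Proof. by rewrite /rs of_real_one; apply: scal_one. Qed.

Lemma rs_zero_l {Z : NormedModule K} (x : Z) : rs 0 x = zero.
Proof. by rewrite /rs of_real_zero; apply: scal_zero_l. Qed.

Lemma rs_rs {Z : NormedModule K} r s (x : Z) : rs r (rs s x) = rs (r * s) x.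
Proof. by rewrite /rs of_real_mult scal_assoc. Qed.

Lemma rs_plus_l {Z : NormedModule K} r s (x : Z) : rs (r + s) x = plus (rs r x) (rs s x).
Proof. by rewrite /rs of_real_plus; apply: scal_distr_r. Qed.

Lemma rs_plus_r {Z : NormedModule K} r (x y : Z) : rs r (plus x y) = plus (rs r x) (rs r y).
Proof. exact: scal_distr_l. Qed.

Lemma rs_zero_r {Z : NormedModule K} r : rs r (zero : Z) = zero.
Proof. exact: scal_zero_r. Qed.

Lemma opp_rs {Z : NormedModule K} (x : Z) : opp x = rs (-1) x.
Proof.
have H : plus x (rs (-1) x) = zero.
  rewrite -{1}(rs_one x) -rs_plus_l; have -> : 1 + -1 = 0 by ring.
  exact: rs_zero_l.
by rewrite -(plus_zero_r (opp x)) -H plus_assoc plus_opp_l plus_zero_l.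
Qed.

(** A normed module postulates only [<=]; the converse is the same inequality applied to [/ r] and
    [rs r x]. *)
Lemma norm_rs {Z : NormedModule K} r (x : Z) : norm (rs r x) = Rabs r * norm x.
Proof.
have le s (y : Z) : norm (rs s y) <= Rabs s * norm y.
  by rewrite /rs -(abs_of_real k); apply: norm_scal.
have [->|r0] := Req_dec r 0.
  by rewrite rs_zero_l norm_zero Rabs_R0 Rmult_0_l.
apply: Rle_antisym => //.
have := le (/ r) (rs r x).
rewrite rs_rs Rinv_l // rs_one Rabs_inv => H.
have r1 : 0 < Rabs r by apply: Rabs_pos_lt.
apply: (Rmult_le_reg_l (/ Rabs r)); first exact: Rinv_0_lt_compat.
by rewrite -Rmult_assoc Rinv_l ?Rmult_1_l //; lra.
Qed.

(* Reflection of identities between linear combinations: both sides are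
   compared through their coefficients at the atoms collected in [env]. *)
Inductive vexpr :=
  | VAtom of nat | VZero | VPlus of vexpr & vexpr | VOpp of vexpr | VScal of R & vexpr.

Fixpoint veval {Z : NormedModule K} (env : list Z) (e : vexpr) : Z :=
  match e with
  | VAtom i => List.nth i env zero
  | VZero => zero
  | VPlus e1 e2 => plus (veval env e1) (veval env e2)
  | VOpp e1 => opp (veval env e1)
  | VScal r e1 => rs r (veval env e1)
  end.

Fixpoint vcoef (e : vexpr) (i : nat) : R :=
  match e with
  | VAtom j => if Nat.eqb i j then 1 else 0
  | VZero => 0
  | VPlus e1 e2 => vcoef e1 i + vcoef e2 i
  | VOpp e1 => - vcoef e1 i
  | VScal r e1 => r * vcoef e1 i
  end.

Fixpoint vsum {Z : NormedModule K} (env : list Z) (c : nat -> R) : Z :=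
  match env with
  | nil => zero
  | cons x env' => plus (rs (c 0%nat) x) (vsum env' (fun i => c (S i)))
  end.

Fixpoint vsame {Z : NormedModule K} (env : list Z) (c d : nat -> R) : Prop :=
  match env with
  | nil => True
  | cons _ env' => c 0%nat = d 0%nat /\ vsame env' (fun i => c (S i)) (fun i => d (S i))
  end.

Lemma vsum_ext {Z : NormedModule K} (env : list Z) c d :
  vsame env c d -> vsum env c = vsum env d.
Proof. by elim: env c d => //= x env IH c d [-> /IH ->]. Qed.

Lemma vsum_zero {Z : NormedModule K} (env : list Z) : vsum env (fun _ => 0) = zero.
Proof. by elim: env => //= x env ->; rewrite rs_zero_l plus_zero_l. Qed.

Lemma vsum_plus {Z : NormedModule K} (env : list Z) c d :
  vsum env (fun i => c i + d i) = plus (vsum env c) (vsum env d).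
Proof.
elim: env c d => [|x env IH] c d /=; first by rewrite plus_zero_l.
rewrite (IH (fun i => c (S i)) (fun i => d (S i))) rs_plus_l -!plus_assoc; congr plus.
by rewrite !plus_assoc (plus_comm (rs (d 0%nat) x)).
Qed.

Lemma vsum_scal {Z : NormedModule K} (env : list Z) r c :
  vsum env (fun i => r * c i) = rs r (vsum env c).
Proof.
elim: env c => [|x env IH] c /=; first by rewrite rs_zero_r.
by rewrite (IH (fun i => c (S i))) rs_plus_r rs_rs.
Qed.

Lemma vsum_atom {Z : NormedModule K} (env : list Z) j :
  vsum env (fun i => if Nat.eqb i j then 1 else 0) = List.nth j env zero.
Proof.
elim: env j => [|x env IH] [|j] //=.
  by rewrite rs_one vsum_zero plus_zero_r.
by rewrite rs_zero_l plus_zero_l IH.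
Qed.

Lemma veval_vsum {Z : NormedModule K} (env : list Z) e :
  veval env e = vsum env (vcoef e).
Proof.
elim: e => [j||e1 IH1 e2 IH2|e IH|r e IH] /=.
- by rewrite vsum_atom.
- by rewrite vsum_zero.
- by rewrite IH1 IH2 vsum_plus.
- rewrite IH opp_rs -vsum_scal; apply: vsum_ext.
  by elim: env (vcoef e) {IH} => //= x env IH c; split; [ring | apply: IH].
- by rewrite IH vsum_scal.
Qed.

Lemma veval_eq {Z : NormedModule K} (env : list Z) e1 e2 :
  vsame env (vcoef e1) (vcoef e2) -> veval env e1 = veval env e2.
Proof. by rewrite !veval_vsum; apply: vsum_ext. Qed.

End RealScalars.

Ltac vec_index x l :=
  lazymatch l with
  | cons x _ => constr:(O)
  | cons _ ?l' => let i := vec_index x l' in constr:(S i)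
  end.

Ltac vec_add x l :=
  match l with
  | _ => let _ := vec_index x l in l
  | _ => constr:(cons x l)
  end.

Ltac vec_atoms l e :=
  lazymatch e with
  | plus ?a ?b => let l1 := vec_atoms l a in vec_atoms l1 b
  | minus ?a ?b => let l1 := vec_atoms l a in vec_atoms l1 b
  | opp ?a => vec_atoms l a
  | rs _ ?a => vec_atoms l a
  | zero => l
  | _ => vec_add e l
  end.

Ltac vec_reify l e :=
  lazymatch e with
  | plus ?a ?b => let x := vec_reify l a in let y := vec_reify l b in constr:(VPlus x y)
  | minus ?a ?b => let x := vec_reify l a in let y := vec_reify l b in constr:(VPlus x (VOpp y))
  | opp ?a => let x := vec_reify l a in constr:(VOpp x)
  | rs ?r ?a => let x := vec_reify l a in constr:(VScal r x)
  | zero => constr:(VZero)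
  | _ => let i := vec_index e l in constr:(VAtom i)
  end.

(* Coefficient equalities whose [field] side conditions depend on hypotheses are left open; callers
   close them with [field; rlra]. *)
Tactic Notation "vec" constr(Z) :=
  lazymatch goal with
  | |- ?a = ?b =>
    let l0 := constr:(@nil Z) in
    let l1 := vec_atoms l0 a in
    let l := vec_atoms l1 b in
    let x := vec_reify l a in
    let y := vec_reify l b in
    change (@veval _ Z l x = @veval _ Z l y); apply: veval_eq; cbn -[Rplus Rmult Ropp Rinv IZR];
    repeat split; try (by ring); try (by field)
  end.

(** * Limits, Neumann series and uniform boundedness *)

Lemma Rle_of_eps (x y : R) : (forall e, 0 < e -> x <= y + e) -> x <= y.
Proof. exact: le_epsilon. Qed.

Lemma half_pow_small (e : R) : 0 < e -> exists N, forall n, (N <= n)%coq_nat -> (/2) ^ n < e.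
Proof.
move=> e0; have h : Rabs (/2) < 1 by rewrite Rabs_pos_eq; rlra.
have [N HN] := pow_lt_1_zero _ h _ e0; exists N => n Nn.
have := HN n Nn; rewrite Rabs_pos_eq //; apply: pow_le; rlra.
Qed.

Lemma at_right_iff (P : R -> Prop) :
  at_right 0 P <-> exists d, 0 < d /\ forall h, 0 < h < d -> P h.
Proof.
split=> [[d Hd]|[d [d0 Hd]]].
  exists d; split; first exact: cond_pos.
  move=> h hh; apply: Hd; last by case: hh.
  by change (Rabs (h - 0) < d); rewrite Rabs_pos_eq; rlra.
exists (mkposreal d d0) => h; change (Rabs (h - 0) < d -> 0 < h -> P h) => h1 h0.
by apply: Hd; rewrite Rabs_pos_eq in h1; rlra.
Qed.

Section Banach.
Context {k : scalars}.
Local Notation K := (field_of k).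

Lemma linear_rs {U V : NormedModule K} (L : U -> V) r x :
  is_linear L -> L (rs r x) = rs r (L x).
Proof. by move=> HL; rewrite /rs linear_scal. Qed.

Lemma eq_of_norm_le {Z : NormedModule K} (x y : Z) :
  (forall e, 0 < e -> norm (minus x y) <= e) -> x = y.
Proof.
move=> H; apply: (plus_reg_r (opp y)); rewrite plus_opp_r; apply: norm_eq_zero.
apply: Rle_antisym (norm_ge_0 _); apply: Rle_of_eps => e e0; rewrite Rplus_0_l.
exact: H.
Qed.

Lemma norm_minus_sym {Z : NormedModule K} (x y : Z) : norm (minus x y) = norm (minus y x).
Proof. by rewrite -norm_opp opp_minus. Qed.

Lemma norm_minus_triangle {Z : NormedModule K} (x y z : Z) :
  norm (minus x z) <= norm (minus x y) + norm (minus y z).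
Proof.
apply: Rle_trans (norm_triangle _ _); apply: Req_le; congr norm; vec Z.
Qed.

Lemma norm_le_minus {Z : NormedModule K} (x y : Z) : norm x <= norm (minus x y) + norm y.
Proof.
apply: Rle_trans (norm_triangle _ _); apply: Req_le; congr norm; vec Z.
Qed.

Lemma norm_minus_le {Z : NormedModule K} (x y : Z) : norm (minus x y) <= norm x + norm y.
Proof. by rewrite -(norm_opp y); apply: norm_triangle. Qed.

Lemma filterlim_eps {T : Type} {Z : NormedModule K} {F : (T -> Prop) -> Prop} {FF : Filter F}
    (f : T -> Z) y :
  filterlim f F (locally y) <-> forall e, 0 < e -> F (fun t => norm (minus (f t) y) < e).
Proof.
rewrite filterlim_locally_ball_norm; split=> H.
  by move=> e e0; apply: (H (mkposreal e e0)).
by move=> [e e0]; apply: H.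
Qed.

Lemma right_lim_eps {Z : NormedModule K} (f : R -> Z) y :
  filterlim f (at_right 0) (locally y) <->
  forall e, 0 < e -> exists d, 0 < d /\ forall h, 0 < h < d -> norm (minus (f h) y) < e.
Proof.
rewrite filterlim_eps; split=> H e e0; first by apply/at_right_iff; apply: H.
by apply/at_right_iff; apply: H.
Qed.

Lemma right_lim_ext {Z : NormedModule K} (f g : R -> Z) y :
  (forall h, 0 < h < 1 -> f h = g h) ->
  filterlim f (at_right 0) (locally y) -> filterlim g (at_right 0) (locally y).
Proof.
move=> fg; apply: filterlim_ext_loc; apply/at_right_iff.
by exists 1; split; [rlra | exact: fg].
Qed.

Lemma continuous_eps {Z : NormedModule K} (f : R -> Z) t :
  continuous f t <->
  forall e, 0 < e -> exists d, 0 < d /\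
    forall s, Rabs (s - t) < d -> norm (minus (f s) (f t)) < e.
Proof.
rewrite /continuous filterlim_eps; split=> H e e0.
  have [d Hd] := H e e0; exists d; split; first exact: cond_pos.
  by move=> s st; apply: Hd.
have [d [d0 Hd]] := H e e0; exists (mkposreal d d0) => s st; exact: Hd.
Qed.

Lemma lim_plus {T : Type} {Z : NormedModule K} {F : (T -> Prop) -> Prop} {FF : Filter F}
    (f g : T -> Z) a b :
  filterlim f F (locally a) -> filterlim g F (locally b) ->
  filterlim (fun t => plus (f t) (g t)) F (locally (plus a b)).
Proof. by move=> Hf Hg; exact: filterlim_comp_2 Hf Hg (filterlim_plus a b). Qed.

Lemma right_lim_plus {Z : NormedModule K} (f g : R -> Z) a b :
  filterlim f (at_right 0) (locally a) -> filterlim g (at_right 0) (locally b) ->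
  filterlim (fun t => plus (f t) (g t)) (at_right 0) (locally (plus a b)).
Proof. exact: lim_plus. Qed.

Lemma lim_linear {T : Type} {U V : NormedModule K} {F : (T -> Prop) -> Prop}
    (L : U -> V) (f : T -> U) a :
  is_linear L -> filterlim f F (locally a) -> filterlim (fun t => L (f t)) F (locally (L a)).
Proof. by move=> HL Hf; apply: (filterlim_comp _ _ _ _ _ _ _ _ Hf); apply: linear_cont. Qed.

Lemma continuous_linear {U V : NormedModule K} (L : U -> V) (f : R -> U) t :
  is_linear L -> continuous f t -> continuous (fun s => L (f s)) t.
Proof. exact: lim_linear. Qed.

Lemma continuous_comp_R {Z : UniformSpace} (f : R -> Z) (g : R -> R) t :
  continuous g t -> continuous f (g t) -> continuous (fun s => f (g s)) t.
Proof. exact: continuous_comp. Qed.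

Lemma is_linear_rs {Z : NormedModule K} r : is_linear (fun x : Z => rs r x).
Proof.
apply: is_linear_scal_r; case: (k) => x y; first exact: Rmult_comm.
exact: Cmult_comm.
Qed.

Lemma is_linear_add {U V : NormedModule K} (L1 L2 : U -> V) :
  is_linear L1 -> is_linear L2 -> is_linear (fun x => plus (L1 x) (L2 x)).
Proof.
by move=> H1 H2; apply: (is_linear_comp _ _ (is_linear_prod _ _ H1 H2) is_linear_plus).
Qed.

Lemma is_linear_sub {U V : NormedModule K} (L1 L2 : U -> V) :
  is_linear L1 -> is_linear L2 -> is_linear (fun x => minus (L1 x) (L2 x)).
Proof.
by move=> H1 H2; apply: is_linear_add => //; apply: is_linear_comp => //; apply: is_linear_opp.
Qed.

Section Complete.
Context {ZC : CompleteNormedModule K}.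
Local Notation Z := (CompleteNormedModule.NormedModule K ZC).
Implicit Types (x y : Z).

Lemma geometric_lim (u : nat -> Z) c :
  (forall n, norm (minus (u (S n)) (u n)) <= c * (/2) ^ n) ->
  exists l : Z, forall n, norm (minus l (u n)) <= 2 * c * (/2) ^ n.
Proof.
move=> H.
have c0 : 0 <= c.
  have := H O; have := norm_ge_0 (minus (u 1%nat) (u O)); rewrite /= Rmult_1_r; rlra.
(* This is the exact value of the finite geometric sum; with the weaker bound lacking the last
   factor the induction would not close. *)
have Hd n p : norm (minus (u (p + n)%coq_nat) (u n)) <= 2 * c * (/2) ^ n * (1 - (/2) ^ p).
  elim: p => [|p IH]; first by rewrite /= /minus plus_opp_r norm_zero; rlra.
  apply: Rle_trans (norm_minus_triangle _ (u (p + n)%coq_nat) _) _.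
  apply: Rle_trans (Rplus_le_compat _ _ _ _ (H _) IH) _.
  rewrite pow_add /=; apply: Req_le; field.
have Hh p : 0 <= (/2) ^ p by apply: pow_le; rlra.
have Hb n m : (n <= m)%coq_nat -> norm (minus (u m) (u n)) <= 2 * c * (/2) ^ n.
  move=> nm; have -> : m = ((m - n)%coq_nat + n)%coq_nat by lia.
  apply: Rle_trans (Hd _ _) _; rewrite -{2}(Rmult_1_r (2 * c * (/2) ^ n)).
  apply: Rmult_le_compat_l; last by have := Hh (m - n)%coq_nat; rlra.
  by apply: Rmult_le_pos => //; rlra.
have [l Hl] : exists l : Z, filterlim u eventually (locally l).
  apply/(@filterlim_locally_cauchy _ ZC) => e.
  (* The [+ 1] allows [c = 0]. The same device recurs in later epsilon choices. *)
  have e4 : 0 < e / (4 * c + 1).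
    by apply: Rdiv_lt_0_compat; [exact: cond_pos | rlra].
  have [N HN] := half_pow_small _ e4.
  have HN' := HN N (Nat.le_refl _).
  have cN : 4 * c * (/2) ^ N < e.
    have := Rmult_lt_compat_r (4 * c + 1) _ _ ltac:(rlra) HN'.
    rewrite /Rdiv Rmult_assoc Rinv_l; last rlra.
    have := Hh N; rnra.
  exists (fun n => (N <= n)%coq_nat); split; first by exists N.
  move=> n m Nn Nm; apply: norm_compat1.
  apply: Rle_lt_trans (norm_minus_triangle _ (u N) _) _.
  rewrite (norm_minus_sym (u N)); have := Hb _ _ Nn; have := Hb _ _ Nm; rlra.
exists l => n; apply: Rle_of_eps => e e0.
have [N HN] := proj1 (filterlim_eps u l) Hl e e0.
have := HN (N + n)%coq_nat ltac:(lia).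
have := norm_minus_triangle l (u (N + n)%coq_nat) (u n).
rewrite (norm_minus_sym l (u (N + n)%coq_nat)); have := Hb n (N + n)%coq_nat ltac:(lia); rlra.
Qed.

(** The iterates [u] are the partial sums of the Neumann series of [L] at [y]. Contraction by one
    half is enough for every use, and [geometric_lim] at [n = 0] then gives the bound on [x]. *)
Lemma neumann (L : Z -> Z) :
  is_linear L -> (forall x, norm (L x) <= /2 * norm x) ->
  forall y, exists x, minus x (L x) = y /\ norm x <= 2 * norm y.
Proof.
move=> HL Lh y.
pose u := fix u n := match n with O => zero | S n => plus y (L (u n)) end.
have Hu n : norm (minus (u (S n)) (u n)) <= norm y * (/2) ^ n.
  elim: n => [|n IH].
    rewrite /= (linear_zero L) // Rmult_1_r; apply: Req_le; congr norm; vec Z.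
  have -> : minus (u (S (S n))) (u (S n)) = L (minus (u (S n)) (u n)).
    rewrite (linear_minus L) //=; vec Z.
  apply: Rle_trans (Lh _) _; change ((/2) ^ S n) with (/2 * (/2) ^ n); rlra.
have [x Hx] := geometric_lim u _ Hu; exists x; split.
  apply: eq_of_norm_le => e e0.
  have e3 : 0 < e / (3 * norm y + 1).
    by apply: Rdiv_lt_0_compat => //; have := norm_ge_0 y; rlra.
  have [N /(_ N (Nat.le_refl _)) HN] := half_pow_small _ e3.
  have -> : minus (minus x (L x)) y = minus (minus x (u (S N))) (L (minus x (u N))).
    rewrite (linear_minus L) //=; vec Z.
  apply: Rle_trans (norm_minus_le _ _) _.
  have := Hx (S N); have := Lh (minus x (u N)); have := Hx N => /= h1 h2 h3.
  have := Rmult_lt_compat_r (3 * norm y + 1) _ _ ltac:(have := norm_ge_0 y; rlra) HN.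
  rewrite /Rdiv Rmult_assoc Rinv_l; last by have := norm_ge_0 y; rlra.
  have : 0 <= (/2) ^ N by apply: pow_le; rlra.
  have := norm_ge_0 y; rnra.
have := Hx O; rewrite /=; have -> : minus x zero = x by vec Z.
rlra.
Qed.

(* Baire's argument: if no ball carried a uniform bound, a nested sequence of
   balls would lead to a point at which the family is unbounded. *)
Lemma uniform_boundedness {I : Type} {V : NormedModule K} (T : I -> Z -> V) :
  (forall i, is_linear (T i)) ->
  (forall x, exists c, forall i, norm (T i x) <= c) ->
  exists M, 0 < M /\ forall i x, norm (T i x) <= M * norm x.
Proof.
move=> HT Hpt.
have [[x0 [r [c [r0 Hc]]]]|Hno] := classic (exists x0 r c, 0 < r /\
    forall i x, norm (minus x x0) <= r -> norm (T i x) <= c).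
  have c0 (i : I) : 0 <= c.
    apply: Rle_trans (norm_ge_0 _) (Hc i x0 _).
    by rewrite /minus plus_opp_r norm_zero; rlra.
  (* [Rabs] and [+ 1] make the constant positive even if [I] is empty, when nothing forces [c] to be
     nonnegative. *)
  exists (2 * Rabs c / r + 1); split.
    by have := Rdiv_le_0_compat (2 * Rabs c) r ltac:(have := Rabs_pos c; rlra) r0; rlra.
  move=> i x; have [x0'|xn] := Req_dec (norm x) 0.
    by rewrite (norm_eq_zero _ x0') (linear_zero (T i)) // !norm_zero; rlra.
  have xp : 0 < norm x by have := norm_ge_0 x; rlra.
  pose s := r / norm x; have s0 : 0 < s by apply: Rdiv_lt_0_compat.
  have h1 : norm (T i (plus x0 (rs s x))) <= c.
    apply: Hc; have -> : minus (plus x0 (rs s x)) x0 = rs s x by vec Z.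
    rewrite norm_rs Rabs_pos_eq; last rlra.
    by rewrite /s; apply: Req_le; field.
  have h2 : norm (T i x0) <= c.
    by apply: Hc; rewrite /minus plus_opp_r norm_zero; rlra.
  have h3 : s * norm (T i x) <= 2 * c.
    have -> : s * norm (T i x) = norm (minus (T i (plus x0 (rs s x))) (T i x0)).
      rewrite -[in LHS](Rabs_pos_eq s); last rlra.
      rewrite -norm_rs -(linear_rs (T i)) // -(linear_minus (T i)) //; congr norm; congr (T i _); vec Z.
    apply: Rle_trans (norm_minus_le _ _) _; rlra.
  have -> : norm (T i x) = (s * norm (T i x)) * (norm x / r) by rewrite /s; field; rlra.
  have n0 : 0 <= norm x / r by apply: Rdiv_le_0_compat; rlra.
  apply: Rle_trans (Rmult_le_compat_r _ _ _ n0 h3) _.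
  rewrite (Rabs_pos_eq c (c0 i)); have -> : 2 * c * (norm x / r) = 2 * c / r * norm x by field; rlra.
  rlra.
(* One shrinking of the ball, stated for all [r] because [choice] needs a total relation; for
   [r <= 0] the witness is a dummy. *)
have step (xc : Z) (r : R) (n : nat) : exists q : Z * R, 0 < r ->
    0 < q.2 <= r / 2 /\ norm (minus q.1 xc) <= r / 2 /\
    forall y : Z, norm (minus y q.1) <= q.2 -> exists i, INR n < norm (T i y).
  have [r0|r0] := Rlt_le_dec 0 r; last by exists (xc, r); rlra.
  have [i [x [hx hT]]] : exists (i : I) (x : Z), norm (minus x xc) <= r / 2 /\ INR n < norm (T i x).
    apply: NNPP => H; apply: Hno; exists xc, (r / 2), (INR n); split; first rlra.
    by move=> i x hx; apply: Rnot_lt_le => hT; apply: H; exists i, x.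
  have [M [M0 HM]] := linear_norm _ (HT i).
  pose d := norm (T i x) - INR n; have d0 : 0 < d by rewrite /d; rlra.
  have dM : 0 < d / (2 * M) by apply: Rdiv_lt_0_compat; rlra.
  (* Within [d / (2 * M)] of [x] the value of [T i] moves by at most [d / 2], so its norm stays
     above [INR n]. *)
  exists (x, Rmin (r / 2) (d / (2 * M))) => _ /=; split.
    split; last exact: Rmin_l.
    by apply: Rmin_pos => //; rlra.
  split=> // y hy; exists i.
  have h1 : norm (T i (minus y x)) <= d / 2.
    apply: Rle_trans (HM _) _; apply: Rle_trans (Rmult_le_compat_l M _ _ ltac:(rlra) _) _.
      exact: Rle_trans hy (Rmin_r _ _).
    by apply: Req_le; field; rlra.
  rewrite (linear_minus (T i)) // norm_minus_sym in h1.
  have := norm_le_minus (T i x) (T i y); rewrite /d in h1 d0 *; rlra.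
have [nxt Hnxt] := choice (fun (p : Z * R * nat) (q : Z * R) => 0 < p.1.2 ->
    0 < q.2 <= p.1.2 / 2 /\ norm (minus q.1 p.1.1) <= p.1.2 / 2 /\
    forall y : Z, norm (minus y q.1) <= q.2 -> exists i, INR p.2 < norm (T i y))
  (fun p => step p.1.1 p.1.2 p.2).
pose s := fix s n := match n with O => (zero : Z, 1) | S n => nxt (s n, n) end.
pose cen n : Z := (s n).1; pose rad n : R := (s n).2.
have sP n : 0 < rad n -> 0 < rad (S n) <= rad n / 2 /\
    norm (minus (cen (S n)) (cen n)) <= rad n / 2 /\
    forall y : Z, norm (minus y (cen (S n))) <= rad (S n) -> exists i, INR n < norm (T i y).
  exact: (Hnxt (s n, n)).
have rad1 : rad O = 1 by [].
move: cen rad sP rad1 => cen rad sP rad1 {s}.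
have s0 n : 0 < rad n by elim: n => [|n IH]; [rlra | case: (sP n IH) => [[]]].
have sm n p : rad (p + n)%coq_nat <= rad n * (/2) ^ p.
  elim: p => [|p IH]; first by rewrite /=; rlra.
  have [[_ h] _] := sP (p + n)%coq_nat (s0 _).
  apply: Rle_trans h _; rewrite [(/2) ^ S p]/=; rlra.
have [l Hl] : exists l : Z, forall n, norm (minus l (cen n)) <= rad n.
  have [l Hl] : exists l : Z, forall n, norm (minus l (cen n)) <= 2 * (1 / 2) * (/2) ^ n.
    apply: geometric_lim => n; have [_ [h _]] := sP n (s0 n); apply: Rle_trans h _.
    have := sm O n; rewrite -plus_n_O rad1; rlra.
  (* Closeness to the centres at rate [(/2) ^ n] is not enough: [l] must lie in the n-th ball
     itself, whose radius may be much smaller. The telescoped bound [Hd] keeps all later centres in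
     that ball. *)
  exists l => n; apply: Rle_of_eps => e e0.
  have [N /(_ N (Nat.le_refl _)) HN] := half_pow_small _ e0.
  have Hd p : norm (minus (cen (p + n)%coq_nat) (cen n)) <= rad n * (1 - (/2) ^ p).
    elim: p => [|p IH]; first by rewrite /= /minus plus_opp_r norm_zero; rlra.
    apply: Rle_trans (norm_minus_triangle _ (cen (p + n)%coq_nat) _) _.
    have [_ [h _]] := sP (p + n)%coq_nat (s0 _).
    have := sm n p; rewrite [(/2) ^ S p]/=; change (S p + n)%coq_nat with (S (p + n)%coq_nat).
    rlra.
  have h1 := Hl (N + n)%coq_nat; have h2 := Hd N.
  have h3 := norm_minus_triangle l (cen (N + n)%coq_nat) (cen n).
  have h4 : (/2) ^ (N + n)%coq_nat <= (/2) ^ N.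
    rewrite pow_add -{2}(Rmult_1_r ((/2) ^ N)); apply: Rmult_le_compat_l.
      by apply: pow_le; rlra.
    rewrite -(pow1 n); apply: pow_incr; rlra.
  have h5 : 0 <= rad n * (/2) ^ N.
    by apply: Rmult_le_pos; [apply: Rlt_le | apply: pow_le; rlra].
  rlra.
have [c Hc] := Hpt l.
have [n Hn] := nfloor_ex (Rabs c) (Rabs_pos c).
have [_ [_ H]] := sP (S n) (s0 _).
have [i Hi] := H l (Hl _).
have := Hc i; have := Rle_abs c; rewrite S_INR in Hi; rlra.
Qed.

End Complete.
End Banach.

(** * Integrals of continuous functions *)

Section Integral.
Context {k : scalars}.
Local Notation K := (field_of k).

(** [RInt] takes values in complete modules over the reals. Restriction of scalars keeps the carrier
    and its uniform structure, hence the completeness mixin. *)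
Definition realify_complete (Z : CompleteNormedModule K) : CompleteNormedModule R_AbsRing :=
  CompleteNormedModule.Pack R_AbsRing Z
    (CompleteNormedModule.Class R_AbsRing Z
      (NormedModule.class R_AbsRing (realify Z))
      (CompleteNormedModule.mixin K Z (CompleteNormedModule.class K Z))) Z.

Context {ZC : CompleteNormedModule K}.
Local Notation Z := (CompleteNormedModule.NormedModule K ZC).

Definition integ (f : R -> Z) (a b : R) : Z := @RInt (realify_complete ZC) f a b.

Definition cts (f : R -> Z) := forall t, continuous f t.

Implicit Types (f g : R -> Z) (a b c t : R).

Lemma cts_is_RInt f a b : cts f -> @is_RInt (realify ZC) f a b (integ f a b).
Proof.
move=> Hf; apply: (@RInt_correct (realify_complete ZC)).
by apply: (@ex_RInt_continuous (realify_complete ZC)) => t _; apply: Hf.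
Qed.

Lemma is_RInt_integ f a b (l : Z) : @is_RInt (realify ZC) f a b l -> integ f a b = l.
Proof. exact: (@is_RInt_unique (realify_complete ZC)). Qed.

Lemma integ_ext f g a b : a <= b -> (forall t, a <= t <= b -> f t = g t) ->
  integ f a b = integ g a b.
Proof.
move=> ab fg; apply: (@RInt_ext (realify_complete ZC)) => t.
rewrite Rmin_left // Rmax_right // => -[h1 h2]; apply: fg; rlra.
Qed.

Lemma integ_plus f g a b : cts f -> cts g ->
  integ (fun t => plus (f t) (g t)) a b = plus (integ f a b) (integ g a b).
Proof.
move=> Hf Hg; apply: is_RInt_integ.
by apply: (@is_RInt_plus (realify ZC)); apply: cts_is_RInt.
Qed.

Lemma Riemann_sum_linear (L : Z -> Z) f (p : SF_seq) : is_linear L ->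
  @Riemann_sum (realify ZC) (fun t => L (f t)) p = L (@Riemann_sum (realify ZC) f p).
Proof.
move=> HL; apply: (SF_cons_ind (fun p => @Riemann_sum (realify ZC) (fun t => L (f t)) p =
  L (@Riemann_sum (realify ZC) f p))) => [x|h s IH].
  exact: esym (linear_zero L HL).
rewrite !Riemann_sum_cons IH [RHS](linear_plus L HL); congr plus.
exact: esym (linear_rs L _ _ HL).
Qed.

(** A bounded linear map commutes with Riemann sums and with their limit. *)
Lemma integ_linear (L : Z -> Z) f a b : is_linear L -> cts f ->
  integ (fun t => L (f t)) a b = L (integ f a b).
Proof.
move=> HL Hf; apply: is_RInt_integ.
have := lim_linear _ _ _ HL (cts_is_RInt f a b Hf); apply: filterlim_ext => p.
rewrite Riemann_sum_linear //; exact: (linear_rs L _ _ HL).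
Qed.

Lemma integ_chasles f a b c : cts f -> plus (integ f a b) (integ f b c) = integ f a c.
Proof.
move=> Hf; apply: (@RInt_Chasles (realify_complete ZC)); eexists; exact: cts_is_RInt.
Qed.

Lemma integ_point f a : integ f a a = zero.
Proof. exact: (@RInt_point (realify_complete ZC)). Qed.

Lemma cts_shift f c : cts f -> cts (fun t => f (t + c)).
Proof.
move=> Hf t; apply: continuous_comp_R => //.
apply: continuous_plus; [exact: continuous_id | exact: continuous_const].
Qed.

Lemma integ_shift f a b c : cts f ->
  integ (fun t => f (t + c)) a b = integ f (a + c) (b + c).
Proof.
move=> Hf; have := @RInt_comp_lin (realify_complete ZC) f 1 c a b.
rewrite !Rmult_1_l => H; rewrite [RHS]/integ -H; last by eexists; apply: cts_is_RInt.
apply: (@RInt_ext (realify_complete ZC)) => t _; rewrite Rmult_1_l.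
exact: esym (@scal_one _ (realify ZC) _).
Qed.

Lemma norm_integ_le f (g : R -> R) a b lg : cts f -> a <= b ->
  (forall t, a <= t <= b -> norm (f t) <= g t) -> is_RInt g a b lg ->
  norm (integ f a b) <= lg.
Proof.
move=> Hf ab fg Hg.
exact: (@norm_RInt_le (realify ZC) f g a b _ _ ab fg (cts_is_RInt f a b Hf) Hg).
Qed.

Lemma norm_integ_const f a b c : cts f -> a <= b ->
  (forall t, a <= t <= b -> norm (f t) <= c) -> norm (integ f a b) <= (b - a) * c.
Proof.
move=> Hf ab fc.
exact: (@norm_RInt_le_const (realify ZC) f a b _ _ ab fc (cts_is_RInt f a b Hf)).
Qed.

(** The bound is uniform in [t], because the end term of the primitive has a favourable sign. Both
    the resolvent estimate and the contraction of the Volterra operator take their factor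
    [/ (l - w)] from here. *)
Lemma norm_integ_exp f a c t : cts f -> 0 < a -> 0 <= t ->
  (forall s, 0 <= s <= t -> norm (f s) <= c * exp (- a * s)) -> norm (integ f 0 t) <= c / a.
Proof.
move=> Hf a0 t0 Hb.
have c0 : 0 <= c.
  have := Hb 0 ltac:(rlra); rewrite Rmult_0_r exp_0; have := norm_ge_0 (f 0); rlra.
have HI : is_RInt (fun s => c * exp (- a * s)) 0 t (c / a - c / a * exp (- a * t)).
  have -> : c / a - c / a * exp (- a * t) =
      minus (- (c / a) * exp (- a * t)) (- (c / a) * exp (- a * 0)).
    by rewrite /minus /plus /opp /= Rmult_0_r exp_0; field; rlra.
  apply: (is_RInt_derive (fun s => - (c / a) * exp (- a * s))) => s _.
    by auto_derive => //; field; rlra.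
  by apply: (ex_derive_continuous (fun s => c * exp (- a * s))); auto_derive.
apply: Rle_trans (norm_integ_le _ _ _ _ _ Hf t0 Hb HI) _.
have : 0 <= c / a * exp (- a * t); last rlra.
by apply: Rmult_le_pos; [apply: Rdiv_le_0_compat | apply: Rlt_le; apply: exp_pos].
Qed.

Lemma cts_const (x : Z) : cts (fun _ => x).
Proof. by move=> t; apply: continuous_const. Qed.

Lemma cts_plus f g : cts f -> cts g -> cts (fun t => plus (f t) (g t)).
Proof. by move=> Hf Hg t; apply: (lim_plus _ _ _ _ (Hf t) (Hg t)). Qed.

Lemma cts_linear (L : Z -> Z) f : is_linear L -> cts f -> cts (fun t => L (f t)).
Proof. by move=> HL Hf t; apply: (continuous_linear L). Qed.

Lemma cts_minus f g : cts f -> cts g -> cts (fun t => minus (f t) (g t)).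
Proof. by move=> Hf Hg; apply: cts_plus => //; apply: cts_linear => //; apply: is_linear_opp. Qed.

Lemma integ_minus f g a b : cts f -> cts g ->
  integ (fun t => minus (f t) (g t)) a b = minus (integ f a b) (integ g a b).
Proof.
move=> Hf Hg; rewrite integ_plus //; last by apply: cts_linear => //; apply: is_linear_opp.
by rewrite (integ_linear opp) //; apply: is_linear_opp.
Qed.

Lemma integ_const (x : Z) a b : integ (fun _ => x) a b = rs (b - a) x.
Proof. exact: (@RInt_const (realify_complete ZC)). Qed.

Lemma integ_approx f a b (x : Z) e : cts f -> a <= b ->
  (forall t, a <= t <= b -> norm (minus (f t) x) <= e) ->
  norm (minus (integ f a b) (rs (b - a) x)) <= (b - a) * e.
Proof.
move=> Hf ab He; rewrite -(integ_const x) -integ_minus //; last exact: cts_const.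
by apply: norm_integ_const => //; apply: cts_minus => //; apply: cts_const.
Qed.

Lemma integ_mean f a : cts f ->
  filterlim (fun h => rs (/ h) (integ f a (a + h))) (at_right 0) (locally (f a)).
Proof.
move=> Hf; apply/right_lim_eps => e e0.
have [d [d0 Hd]] := proj1 (continuous_eps f a) (Hf a) (e / 2) ltac:(rlra).
exists d; split=> // h hh.
have -> : minus (rs (/ h) (integ f a (a + h))) (f a) =
    rs (/ h) (minus (integ f a (a + h)) (rs (a + h - a) (f a))).
  by vec Z; field; rlra.
have h1 : norm (minus (integ f a (a + h)) (rs (a + h - a) (f a))) <= (a + h - a) * (e / 2).
  apply: integ_approx => //; first rlra.
  move=> t ht; apply: Rlt_le; apply: Hd; rewrite Rabs_pos_eq; rlra.
rewrite norm_rs Rabs_pos_eq; last by apply: Rlt_le; apply: Rinv_0_lt_compat; rlra.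
apply: Rle_lt_trans (_ : / h * (h * (e / 2)) < e).
  apply: Rmult_le_compat_l; last rlra.
  by apply: Rlt_le; apply: Rinv_0_lt_compat; rlra.
by rewrite -Rmult_assoc Rinv_l; rlra.
Qed.

Lemma unif_cts f a b e : cts f -> 0 < e ->
  exists d, 0 < d /\ forall s t, a <= s <= b -> a <= t <= b -> Rabs (t - s) < d ->
    norm (minus (f t) (f s)) < e.
Proof.
move=> Hf e0; have [d Hd] := @unifcont_normed_1d _ Z f a b (fun x _ => Hf x) (mkposreal e e0).
exists d; split; first exact: cond_pos.
by move=> s t hs ht st; apply: Hd.
Qed.

Lemma cts_bounded f a b : cts f -> exists c, 0 < c /\ forall t, a <= t <= b -> norm (f t) <= c.
Proof.
move=> Hf; have [M HM] := @bounded_continuity _ Z f a b (fun x _ => Hf x).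
exists (Rabs M + 1); split; first by have := Rabs_pos M; rlra.
by move=> t ht; have := HM t ht; have := Rle_abs M; rlra.
Qed.

Lemma cts_comp f (g : R -> R) : cts f -> (forall t, continuous g t) -> cts (fun t => f (g t)).
Proof. by move=> Hf Hg t; apply: continuous_comp_R. Qed.

Lemma continuous_Rmax0 t : continuous (Rmax 0) t.
Proof.
apply/continuity_pt_filterlim => e e0; exists e; split=> // s [_ hs].
apply: Rle_lt_trans hs; rewrite /dist /= /R_dist /Rmax.
case: (Rle_dec 0 s) => hs; case: (Rle_dec 0 t) => ht;
  split_Rabs; rlra.
Qed.

Lemma cts_Rmax0 f : cts f -> cts (fun t => f (Rmax 0 t)).
Proof. by move=> Hf; apply: cts_comp => // t; apply: continuous_Rmax0. Qed.

End Integral.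

(** * Semigroups and their generators *)

Section Semigroup.
Context {k : scalars}.
Local Notation K := (field_of k).

Lemma lim_rs {T : Type} {Z : NormedModule K} {F : (T -> Prop) -> Prop} {FF : Filter F}
    (r : T -> R) (u : T -> Z) (r0 : R) (x : Z) :
  filterlim r F (locally r0) -> filterlim u F (locally x) ->
  filterlim (fun t => rs (r t) (u t)) F (locally (rs r0 x)).
Proof.
move=> Hr Hu.
exact: (filterlim_comp_2 _ _ _ Hr Hu (@filterlim_scal R_AbsRing (realify Z) r0 x)).
Qed.

Lemma is_linear_scal {Z : NormedModule K} (a : K) : is_linear (fun x : Z => scal a x).
Proof.
apply: is_linear_scal_r; case: (k) => x y; first exact: Rmult_comm.
exact: Cmult_comm.
Qed.

Lemma scal_rs {Z : NormedModule K} (a : K) r (x : Z) : scal a (rs r x) = rs r (scal a x).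
Proof. exact: linear_rs _ _ _ (is_linear_scal a). Qed.

Lemma scal_minus {Z : NormedModule K} (a : K) (x y : Z) :
  scal a (minus x y) = minus (scal a x) (scal a y).
Proof. exact: linear_minus _ _ _ (is_linear_scal a). Qed.

Context {ZC : CompleteNormedModule K}.
Local Notation Z := (CompleteNormedModule.NormedModule K ZC).

Implicit Types (S T : R -> Z -> Z) (x y z : Z) (s t h : R).

Definition gen S x y : Prop :=
  filterlim (fun h => rs (/ h) (minus (S h x) x)) (at_right 0) (locally y).

(* A C0-semigroup extended to all of R by S t = S 0 for t < 0, so that its
   orbits are continuous on R, together with a growth bound. *)
Record semigroup S (M w : R) : Prop := {
  sg_linear : forall t, is_linear (S t);
  sg_zero : forall x, S 0 x = x;
  sg_add : forall s t x, 0 <= s -> 0 <= t -> S (t + s) x = S t (S s x);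
  sg_cts : forall x, cts (fun t => S t x);
  sg_max : forall t x, S t x = S (Rmax 0 t) x;
  sg_M : 1 <= M;
  sg_w : 0 <= w;
  sg_bound : forall t x, 0 <= t -> norm (S t x) <= M * exp (w * t) * norm x }.

Lemma gen_ext S T x y : (forall t, 0 < t -> S t x = T t x) -> gen S x y -> gen T x y.
Proof. by move=> ST; apply: right_lim_ext => h [h0 _]; rewrite ST. Qed.

Lemma gen_unique S x y y' : gen S x y -> gen S x y' -> y = y'.
Proof. by move=> H H'; apply: (filterlim_locally_unique _ _ _ H H'). Qed.

Lemma gen_plus S x y x' y' : (forall t, is_linear (S t)) ->
  gen S x y -> gen S x' y' -> gen S (plus x x') (plus y y').
Proof.
move=> HS H H'; apply: (filterlim_ext _ _ _ (lim_plus _ _ _ _ H H')) => h.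
by rewrite (linear_plus _ (HS h)); vec Z.
Qed.

Lemma gen_scal S a x y : (forall t, is_linear (S t)) ->
  gen S x y -> gen S (scal a x) (scal a y).
Proof.
move=> HS H; apply: (filterlim_ext _ _ _ (lim_linear _ _ _ (is_linear_scal a) H)) => h.
by rewrite (linear_scal _ (HS h)) scal_rs scal_minus.
Qed.

Lemma gen_rs S r x y : (forall t, is_linear (S t)) ->
  gen S x y -> gen S (rs r x) (rs r y).
Proof. exact: gen_scal. Qed.

Lemma gen_minus S x y x' y' : (forall t, is_linear (S t)) ->
  gen S x y -> gen S x' y' -> gen S (minus x x') (minus y y').
Proof.
move=> HS H H'; rewrite /minus !opp_rs; apply: gen_plus => //; exact: gen_rs.
Qed.

(** Orbits frozen at negative times are continuous on R, hence bounded on [[0, 1]]; uniform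
    boundedness gives one constant [M] there. Each further unit of time costs a factor [M], which is
    growth at rate [ln M]. *)
Lemma C0_normalize S : is_C0_semigroup S ->
  exists T M w, semigroup T M w /\ forall t x, 0 <= t -> T t x = S t x.
Proof.
move=> [Hlin [H0 [Hadd Hcont]]].
pose T t x := S (Rmax 0 t) x.
have TE t x : 0 <= t -> T t x = S t x by move=> t0; rewrite /T Rmax_right.
have Tlin t : is_linear (T t) by apply: Hlin; apply: Rmax_l.
have Tcts x : cts (fun t => T t x).
  move=> t; apply: (filterlim_comp _ _ _ (Rmax 0) (fun s => S s x) _ _ _ _
    (Hcont x (Rmax 0 t) (Rmax_l _ _))) => P HP.
  have := continuous_Rmax0 t _ HP; rewrite /filtermap /within; apply: filter_imp => s Ps.
  by apply: Ps; apply: Rmax_l.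
have Tadd s t x : 0 <= s -> 0 <= t -> T (t + s) x = T t (T s x).
  by move=> s0 t0; rewrite !TE //; [apply: Hadd | rlra].
have [M0 [M00 HM0]] : exists M, 0 < M /\ forall (i : {t | 0 <= t <= 1}) x,
    norm (T (proj1_sig i) x) <= M * norm x.
  apply: (uniform_boundedness (fun (i : {t | 0 <= t <= 1}) => T (proj1_sig i))) => [i|x].
    exact: Tlin.
  have [c [_ Hc]] := cts_bounded _ 0 1 (Tcts x).
  by exists c => -[t ht]; apply: Hc.
(* The [+ 1] ensures that the rate [ln M] is positive. *)
pose M := M0 + 1; have M1 : 1 < M by rewrite /M; rlra.
have HM t x : 0 <= t <= 1 -> norm (T t x) <= M * norm x.
  move=> ht; apply: Rle_trans (HM0 (exist _ t ht) x) _; rewrite /M.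
  have := norm_ge_0 x; rlra.
have w0 : 0 < ln M by rewrite -ln_1; apply: ln_increasing; rlra.
exists T, M, (ln M); split=> //; split=> //; try rlra.
- by move=> x; rewrite TE ?H0 //; rlra.
- by move=> t x; rewrite /T [in RHS]Rmax_right //; apply: Rmax_l.
have Hn n : forall t x, 0 <= t <= INR n + 1 -> norm (T t x) <= M * exp (ln M * t) * norm x.
  elim: n => [|n IH] t x ht.
    rewrite /= in ht; apply: Rle_trans (HM t x ltac:(rlra)) _.
    apply: Rmult_le_compat_r; first exact: norm_ge_0.
    rewrite -{1}(Rmult_1_r M); apply: Rmult_le_compat_l; first rlra.
    by rewrite -exp_0; case: (Req_dec t 0) => [->|t0]; [rewrite Rmult_0_r; rlra |
       apply: Rlt_le; apply: exp_increasing; apply: Rmult_lt_0_compat; rlra].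
  have [t1|t1] := Rle_lt_dec t (INR n + 1); first by apply: IH; rlra.
  have n0 := pos_INR n; rewrite S_INR in ht.
  have -> : t = 1 + (t - 1) by ring.
  rewrite Tadd; try rlra; apply: Rle_trans (HM 1 _ ltac:(rlra)) _.
  rewrite Rmult_plus_distr_l exp_plus Rmult_1_r exp_ln; last rlra.
  rewrite (Rmult_assoc M).
  apply: Rmult_le_compat_l; first rlra.
  by apply: IH; rlra.
move=> t x t0; have [n Hnt] := nfloor_ex t t0.
by apply: (Hn n); rlra.
Qed.

Lemma semigroup_C0 S M w : semigroup S M w -> is_C0_semigroup S.
Proof.
move=> H; split; first by move=> t _; apply: sg_linear H t.
split; first exact: sg_zero H.
split; first exact: sg_add H.
by move=> x t _; apply: filterlim_filter_le_1 (sg_cts _ _ _ H x t); apply: filter_le_within.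
Qed.

Section Fixed.
Variables (S : R -> Z -> Z) (M w : R).
Hypothesis HS : semigroup S M w.

Lemma sg_minus t x y : S t (minus x y) = minus (S t x) (S t y).
Proof. exact: linear_minus (sg_linear _ _ _ HS t). Qed.

Lemma sg_plus t x y : S t (plus x y) = plus (S t x) (S t y).
Proof. exact: linear_plus (sg_linear _ _ _ HS t) x y. Qed.

Lemma sg_rs t r x : S t (rs r x) = rs r (S t x).
Proof. exact: linear_rs _ _ _ (sg_linear _ _ _ HS t). Qed.

Lemma sg_comm s t x : 0 <= s -> 0 <= t -> S t (S s x) = S s (S t x).
Proof. by move=> s0 t0; rewrite -!(sg_add _ _ _ HS) // Rplus_comm. Qed.

Lemma gen_orbit t x y : 0 <= t -> gen S x y -> gen S (S t x) (S t y).
Proof.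
move=> t0 H; apply: (right_lim_ext _ _ _ _ (lim_linear _ _ _ (sg_linear _ _ _ HS t) H)) => h hh.
by rewrite sg_rs sg_minus (sg_comm h t) //; rlra.
Qed.

Lemma integ_orbit_linear t : 0 <= t -> is_linear (fun x => integ (fun s => S s x) 0 t).
Proof.
move=> t0; split.
- move=> x y; rewrite -integ_plus; try exact: sg_cts HS _.
  by apply: integ_ext => // s _; apply: sg_plus.
- move=> a x; rewrite -(integ_linear (scal a)); last exact: sg_cts HS _.
    by apply: integ_ext => // s _; exact: (linear_scal _ (sg_linear _ _ _ HS s)).
  exact: is_linear_scal.
have M1 := sg_M _ _ _ HS; have w0 := sg_w _ _ _ HS.
have c0 : 0 <= t * (M * exp (w * t)).
  by apply: Rmult_le_pos => //; apply: Rmult_le_pos; [rlra | apply: Rlt_le; apply: exp_pos].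
exists (t * (M * exp (w * t)) + 1); split; first rlra.
move=> x; apply: Rle_trans (_ : (t - 0) * (M * exp (w * t) * norm x) <= _).
  apply: norm_integ_const => //; first exact: sg_cts HS _.
  move=> s hs; apply: Rle_trans (sg_bound _ _ _ HS s x ltac:(rlra)) _.
  apply: Rmult_le_compat_r; first exact: norm_ge_0.
  apply: Rmult_le_compat_l; first rlra.
  case: (Rle_lt_or_eq_dec (w * s) (w * t)) => [|h|->]; last rlra.
    by apply: Rmult_le_compat_l; rlra.
  by apply: Rlt_le; apply: exp_increasing.
have := norm_ge_0 x; rnra.
Qed.

(** Applying [S h] shifts the window of integration by [h], and the common part of the two windows
    cancels. *)
Lemma integ_orbit_diff t h x : 0 <= t -> 0 <= h ->
  minus (integ (fun s => S s (S h x)) 0 t) (integ (fun s => S s x) 0 t) =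
  minus (integ (fun s => S s x) t (t + h)) (integ (fun s => S s x) 0 (0 + h)).
Proof.
move=> t0 h0; have Hc := sg_cts _ _ _ HS x.
have -> : integ (fun s => S s (S h x)) 0 t = integ (fun s => S s x) (0 + h) (t + h).
  rewrite -(integ_shift (fun s => S s x)) //; apply: integ_ext => // s hs.
  by rewrite (sg_add _ _ _ HS) //; rlra.
have e1 : integ (fun s => S s x) (0 + h) (t + h) =
    minus (integ (fun s => S s x) 0 (t + h)) (integ (fun s => S s x) 0 (0 + h)).
  by rewrite -(integ_chasles _ 0 (0 + h) (t + h) Hc); vec Z.
by rewrite e1 -(integ_chasles _ 0 t (t + h) Hc); vec Z.
Qed.

(** One limit yields both halves of the fundamental theorem: [gen_integ] by pulling [S h] out of the
    integral, [integ_gen] by pushing the convergent quotient of [x] through the bounded map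
    [integ_orbit_linear]. No orbit has to be differentiated. *)
Lemma lim_integ_orbit_diff t x : 0 <= t ->
  filterlim (fun h => rs (/ h) (minus (integ (fun s => S s (S h x)) 0 t)
      (integ (fun s => S s x) 0 t)))
    (at_right 0) (locally (minus (S t x) x)).
Proof.
move=> t0; have Hc := sg_cts _ _ _ HS x.
have H0 := integ_mean _ 0 Hc; rewrite (sg_zero _ _ _ HS) in H0.
have H1 := lim_linear _ _ _ is_linear_opp H0.
apply: (right_lim_ext _ _ _ _ (lim_plus _ _ _ _ (integ_mean _ t Hc) H1)) => h hh.
by rewrite integ_orbit_diff //; [vec Z | rlra].
Qed.

Lemma gen_integ t x : 0 <= t -> gen S (integ (fun s => S s x) 0 t) (minus (S t x) x).
Proof.
move=> t0; apply: right_lim_ext (lim_integ_orbit_diff t x t0) => h hh; congr rs; congr minus.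
rewrite -(integ_linear (S h)); [|exact: sg_linear HS h|exact: sg_cts HS x].
by apply: integ_ext => // s hs; apply: sg_comm; rlra.
Qed.

Lemma integ_gen t x y : 0 <= t -> gen S x y -> integ (fun s => S s y) 0 t = minus (S t x) x.
Proof.
move=> t0 H.
have HJ := integ_orbit_linear t t0.
apply: (filterlim_locally_unique _ _ _ (lim_linear _ _ _ HJ H)).
apply: filterlim_ext (lim_integ_orbit_diff t x t0) => h.
by rewrite (linear_rs _ _ _ HJ) (linear_minus _ _ _ HJ).
Qed.

(** The averages of the orbit over short intervals lie in the domain by [gen_integ] and tend to
    [x]. *)
Lemma gen_dense x e : 0 < e -> exists y z, gen S y z /\ norm (minus y x) < e.
Proof.
move=> e0; have H0 := integ_mean _ 0 (sg_cts _ _ _ HS x); rewrite (sg_zero _ _ _ HS) in H0.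
have [d [d0 Hd]] := proj1 (right_lim_eps _ _) H0 e e0.
exists (rs (/ (d / 2)) (integ (fun s => S s x) 0 (0 + d / 2))); eexists; split.
  by apply: gen_rs (sg_linear _ _ _ HS) _; apply: gen_integ; rlra.
by apply: Hd; rlra.
Qed.

End Fixed.

(** [Rmax 0 t] keeps the rescaled family frozen at negative times, as [sg_max] requires. *)
Definition rescale (l : R) S : R -> Z -> Z := fun t x => rs (exp (- l * Rmax 0 t)) (S t x).

Lemma gen_rescale l S x y : gen S x y -> gen (rescale l S) x (minus y (rs l x)).
Proof.
move=> H.
have He : filterlim (fun h => (exp (- l * h) - 1) / h) (at_right 0) (locally (- l)).
  have : is_derive (fun h => exp (- l * h)) 0 (- l).
    by auto_derive => //; rewrite Rmult_0_r exp_0; ring.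
  move/is_derive_Reals => Hd.
  apply/(filterlim_locally (F := at_right 0)) => e; apply/at_right_iff.
  have [d Hd'] := Hd e (cond_pos e); exists d; split; first exact: cond_pos.
  move=> h [h0 hd].
  have := Hd' h ltac:(rlra) ltac:(rewrite Rabs_pos_eq; rlra).
  by rewrite Rplus_0_l Rmult_0_r exp_0.
have He1 : filterlim (fun h => exp (- l * h)) (at_right 0) (locally 1).
  have : continuous (fun h => exp (- l * h)) 0.
    by apply: (ex_derive_continuous (fun h => exp (- l * h))); auto_derive.
  rewrite /continuous Rmult_0_r exp_0 => Hc.
  by apply: filterlim_filter_le_1 Hc; apply: filter_le_within.
have Hc : filterlim (fun _ : R => x) (at_right 0) (locally x) by apply: filterlim_const.
have -> : minus y (rs l x) = plus (rs 1 y) (rs (- l) x) by vec Z.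
apply: (right_lim_ext _ _ _ _
  (right_lim_plus _ _ _ _ (lim_rs _ _ _ _ He1 H) (lim_rs _ _ _ _ He Hc))) => h hh; rewrite /rescale Rmax_right; last rlra.
by vec Z; field; rlra.
Qed.

End Semigroup.

(** * The resolvent *)

Section Resolvent.
Context {k : scalars}.
Local Notation K := (field_of k).
Context {ZC : CompleteNormedModule K}.
Local Notation Z := (CompleteNormedModule.NormedModule K ZC).
Implicit Types (S T : R -> Z -> Z) (x y z : Z) (s t h l : R).

Lemma gen_rescale_inv l S x y : gen (rescale l S) x y -> gen S x (plus y (rs l x)).
Proof.
move=> /(gen_rescale (- l)).
have -> : minus y (rs (- l) x) = plus y (rs l x) by vec Z.
apply: gen_ext => t t0; rewrite /rescale rs_rs -exp_plus.
have -> : - - l * Rmax 0 t + - l * Rmax 0 t = 0 by ring.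
by rewrite exp_0 rs_one.
Qed.

Lemma norm_rescale S M w l t x : semigroup S M w -> 0 <= t ->
  norm (rescale l S t x) <= M * norm x * exp (- (l - w) * t).
Proof.
move=> HS t0; rewrite /rescale norm_rs Rabs_pos_eq; last by apply: Rlt_le; apply: exp_pos.
rewrite Rmax_right //.
apply: Rle_trans (Rmult_le_compat_l _ _ _ _ (sg_bound _ _ _ HS t x t0)) _.
  by apply: Rlt_le; apply: exp_pos.
have -> : - (l - w) * t = - l * t + w * t by ring.
by rewrite exp_plus; apply: Req_le; ring.
Qed.

Lemma rescale_semigroup l S M w : semigroup S M w -> w <= l -> semigroup (rescale l S) M 0.
Proof.
move=> HS wl; have M1 := sg_M _ _ _ HS; split=> //; try rlra.
- by move=> t; apply: is_linear_comp; [exact: sg_linear HS t | exact: is_linear_rs].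
- by move=> x; rewrite /rescale Rmax_left ?Rmult_0_r ?exp_0 ?rs_one ?(sg_zero _ _ _ HS) //; rlra.
- move=> s t x s0 t0; rewrite /rescale (sg_rs _ _ _ HS) rs_rs (sg_add _ _ _ HS) // -exp_plus.
  by rewrite !Rmax_right //; [congr rs; congr exp; ring | rlra].
- move=> x t; apply: lim_rs; last exact: (sg_cts _ _ _ HS x t).
  apply: (continuous_comp_R (fun s => exp (- l * s)) (Rmax 0)); first exact: continuous_Rmax0.
  by apply: (ex_derive_continuous (fun s => exp (- l * s))); auto_derive.
- by move=> t x; rewrite /rescale [in LHS](sg_max _ _ _ HS) (Rmax_right 0 (Rmax 0 t)) //; apply: Rmax_l.
- move=> t x t0; apply: Rle_trans (norm_rescale _ _ _ l t x HS t0) _.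
  rewrite Rmult_0_l exp_0 Rmult_1_r -[X in _ <= X]Rmult_1_r.
  apply: Rmult_le_compat_l; first by apply: Rmult_le_pos; [rlra | exact: norm_ge_0].
  rewrite -exp_0; have : - (l - w) * t <= 0.
    by have : 0 <= (l - w) * t; [apply: Rmult_le_pos; rlra | rlra].
  by case=> [h|->]; [apply: Rlt_le; apply: exp_increasing | rlra].
Qed.

(* With T t = exp (- l t) S t, the operator I - T 1 is invertible by a Neumann
   series, and - (integral of T over [0, 1]) inverts the generator of T up to
   that factor. *)
Lemma resolvent S M w l : semigroup S M w -> w + 2 * M <= l ->
  exists Q : Z -> Z, is_linear Q /\
    (forall y, gen S (Q y) (minus (rs l (Q y)) y)) /\
    (forall x y, gen S x y -> Q (minus (rs l x) y) = x) /\
    forall y, norm (Q y) <= 2 * M / (l - w) * norm y.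
Proof.
move=> HS hl; have M1 := sg_M _ _ _ HS.
have HT := rescale_semigroup l _ _ _ HS ltac:(rlra).
set T := rescale l S in HT.
(* [exp (l - w)] is at least [1 + (l - w)], hence at least [2 * M]: this is the reason for the
   threshold [w + 2 * M <= l]. *)
have HE x : norm (T 1 x) <= /2 * norm x.
  apply: Rle_trans (norm_rescale _ _ _ l 1 x HS ltac:(rlra)) _.
  have -> : M * norm x * exp (- (l - w) * 1) = (M * exp (- (l - w))) * norm x.
    by rewrite Rmult_1_r; ring.
  apply: Rmult_le_compat_r; first exact: norm_ge_0.
  rewrite exp_Ropp; have h1 := exp_ineq1_le (l - w).
  apply: (Rmult_le_reg_r (exp (l - w))); first exact: exp_pos.
  by rewrite Rmult_assoc Rinv_l; rlra.
(* An eigenvector for [l] would be fixed by [T 1], which halves norms. *)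
have inj x : gen S x (rs l x) -> x = zero.
  move=> /(gen_rescale l); have -> : minus (rs l x) (rs l x) = zero by vec Z.
  move=> H; have := integ_gen _ _ _ HT 1 x zero ltac:(rlra) H.
  rewrite (linear_zero _ (integ_orbit_linear _ _ _ HT 1 ltac:(rlra))) => H0.
  apply: norm_eq_zero; have : norm (T 1 x) = norm x.
    congr norm; apply: (plus_reg_r (opp x)); rewrite plus_opp_r; exact: esym H0.
  by have := HE x; have := norm_ge_0 x; rlra.
have uniq x x' y : gen S x (minus (rs l x) y) -> gen S x' (minus (rs l x') y) -> x = x'.
  move=> H H'; have := gen_minus _ _ _ _ _ (sg_linear _ _ _ HS) H H'.
  have -> : minus (minus (rs l x) y) (minus (rs l x') y) = rs l (minus x x') by vec Z.
  move/inj => H0; apply: (plus_reg_r (opp x')); rewrite plus_opp_r; exact: H0.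
have ex y : exists x, gen S x (minus (rs l x) y) /\ norm x <= 2 * M / (l - w) * norm y.
  have [u [Hu nu]] := neumann (T 1) (sg_linear _ _ _ HT 1) HE y.
  exists (integ (fun s => T s u) 0 1); split.
    have := gen_rescale_inv _ _ _ _ (gen_integ _ _ _ HT 1 u ltac:(rlra)).
    by rewrite -Hu; congr gen; vec Z.
  apply: Rle_trans (norm_integ_exp _ (l - w) (M * norm u) 1 (sg_cts _ _ _ HT u) _ _ _) _; try rlra.
    by move=> s [s0 _]; apply: norm_rescale HS s0.
  have -> : 2 * M / (l - w) * norm y = (M * (2 * norm y)) / (l - w) by field; rlra.
  apply: Rmult_le_compat_r; first by apply: Rlt_le; apply: Rinv_0_lt_compat; rlra.
  by apply: Rmult_le_compat_l; rlra.
have [Q HQ] := choice _ ex.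
exists Q; split; last split; last split.
- split.
  + move=> y y'; apply: (uniq _ _ (plus y y')); first by case: (HQ (plus y y')).
    have := gen_plus _ _ _ _ _ (sg_linear _ _ _ HS) (proj1 (HQ y)) (proj1 (HQ y')).
    by congr gen; vec Z.
  + move=> a y; apply: (uniq _ _ (scal a y)); first by case: (HQ (scal a y)).
    have := gen_scal _ a _ _ (sg_linear _ _ _ HS) (proj1 (HQ y)).
    by rewrite scal_minus scal_rs.
  + exists (2 * M / (l - w)); split; last by move=> y; case: (HQ y).
    by apply: Rdiv_lt_0_compat; rlra.
- by move=> y; case: (HQ y).
- move=> x y H; apply: (uniq _ _ (minus (rs l x) y)); first by case: (HQ (minus (rs l x) y)).
  by have -> : minus (rs l x) (minus (rs l x) y) = y by vec Z.
- by move=> y; case: (HQ y).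
Qed.

End Resolvent.

(** * Bounded perturbations *)

Section BoundedPerturbation.
Context {k : scalars}.
Local Notation K := (field_of k).
Context {ZC : CompleteNormedModule K}.
Local Notation Z := (CompleteNormedModule.NormedModule K ZC).
Variables (S : R -> Z -> Z) (M w : R) (P : Z -> Z) (p l : R).
Hypotheses (HS : semigroup S M w) (HP : is_linear P) (p0 : 0 < p)
  (Pp : forall x : Z, norm (P x) <= p * norm x) (hl : 2 * M * p <= l - w).
Implicit Types (u v g : R -> Z) (x y z : Z) (s t h c : R).

Let M1 : 1 <= M := sg_M _ _ _ HS.
Let w0 : 0 <= w := sg_w _ _ _ HS.

Lemma exp_le a b : a <= b -> exp a <= exp b.
Proof. by case=> [h|->]; [apply: Rlt_le; apply: exp_increasing | rlra]. Qed.

Lemma sg_bound_le t b x : 0 <= b -> t <= b -> norm (S t x) <= M * exp (w * b) * norm x.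
Proof.
move=> b0 tb; rewrite (sg_max _ _ _ HS).
apply: Rle_trans (sg_bound _ _ _ HS _ x (Rmax_l 0 t)) _.
apply: Rmult_le_compat_r; first exact: norm_ge_0.
apply: Rmult_le_compat_l; first rlra.
by apply: exp_le; apply: Rmult_le_compat_l => //; apply: Rmax_lub.
Qed.

(** Strong continuity and local boundedness of [S] together give continuity along a moving
    argument. *)
Lemma cts_sg g : cts g -> cts (fun r => S r (g r)).
Proof.
move=> Hg t; apply/continuous_eps => e e0.
set b := Rabs t + 1; have b0 : 0 <= b by rewrite /b; have := Rabs_pos t; rlra.
set B := M * exp (w * b); have B0 : 0 < B.
  by apply: Rmult_lt_0_compat; [rlra | exact: exp_pos].
have [d1 [d10 H1]] := proj1 (continuous_eps _ t) (sg_cts _ _ _ HS (g t) t) (e / 2) ltac:(rlra).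
have eB : 0 < e / 2 / B by apply: Rdiv_lt_0_compat; rlra.
have [d2 [d20 H2]] := proj1 (continuous_eps _ t) (Hg t) _ eB.
exists (Rmin 1 (Rmin d1 d2)); split; first by apply: Rmin_pos; [rlra | apply: Rmin_pos].
move=> s hs.
have hs0 := Rlt_le_trans _ _ _ hs (Rmin_l _ _).
have hs1 := Rlt_le_trans _ _ _ hs (Rle_trans _ _ _ (Rmin_r _ _) (Rmin_l _ _)).
have hs2 := Rlt_le_trans _ _ _ hs (Rle_trans _ _ _ (Rmin_r _ _) (Rmin_r _ _)).
have sb : s <= b.
  by rewrite /b; have := Rle_abs t; have := Rle_abs (s - t); rlra.
apply: Rle_lt_trans (norm_minus_triangle _ (S s (g t)) _) _.
have := H1 s hs1; have := sg_bound_le s b (minus (g s) (g t)) b0 sb.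
rewrite (sg_minus _ _ _ HS).
have : M * exp (w * b) * norm (minus (g s) (g t)) < e / 2.
  have -> : e / 2 = B * (e / 2 / B) by field; rlra.
  by apply: Rmult_lt_compat_l => //; apply: H2.
rlra.
Qed.

Definition kernel u t r : Z := S r (P (u (t - r))).

(** Frozen at negative times, so that solutions of the integral equation inherit [sg_max] and are
    continuous on all of R. *)
Definition volterra u t : Z := integ (kernel u (Rmax 0 t)) 0 (Rmax 0 t).

Lemma cts_kernel u t : cts u -> cts (kernel u t).
Proof.
move=> Hu; apply: cts_sg; apply: cts_linear => //; apply: cts_comp => // s.
apply: (ex_derive_continuous (fun r => t - r)); auto_derive => //.
Qed.

Lemma kernel_minus u v t r : kernel (fun s => minus (u s) (v s)) t r =
  minus (kernel u t r) (kernel v t r).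
Proof. by rewrite /kernel (linear_minus P) // (sg_minus _ _ _ HS). Qed.

Lemma volterra_minus u v t : cts u -> cts v ->
  volterra (fun s => minus (u s) (v s)) t = minus (volterra u t) (volterra v t).
Proof.
move=> Hu Hv; rewrite /volterra -integ_minus; try exact: cts_kernel.
by apply: integ_ext; [exact: Rmax_l | move=> r _; exact: kernel_minus].
Qed.

Lemma volterra_plus u v t : cts u -> cts v ->
  volterra (fun s => plus (u s) (v s)) t = plus (volterra u t) (volterra v t).
Proof.
move=> Hu Hv; rewrite /volterra -integ_plus; try exact: cts_kernel.
apply: integ_ext; first exact: Rmax_l.
by move=> r _; rewrite /kernel (linear_plus P) // (sg_plus _ _ _ HS).
Qed.

Lemma volterra_scal a u t : cts u ->
  volterra (fun s => scal a (u s)) t = scal a (volterra u t).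
Proof.
move=> Hu; rewrite /volterra -(integ_linear (scal a)); first last.
- exact: cts_kernel.
- exact: is_linear_scal.
apply: integ_ext; first exact: Rmax_l.
by move=> r _; rewrite /kernel (linear_scal P) // (linear_scal _ (sg_linear _ _ _ HS _)).
Qed.

Lemma cts_volterra u : cts u -> cts (volterra u).
Proof.
move=> Hu t0; apply: (continuous_comp_R (fun t => integ (kernel u t) 0 t) (Rmax 0)).
  exact: continuous_Rmax0.
set t := Rmax 0 t0; have t_0 : 0 <= t by apply: Rmax_l.
apply/continuous_eps => e e0.
set B := M * exp (w * (t + 1)) * p.
have B0 : 0 < B by apply: Rmult_lt_0_compat => //; apply: Rmult_lt_0_compat; [rlra | exact: exp_pos].
have kB s v r : r <= t + 1 -> norm (kernel v s r) <= B * norm (v (s - r)).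
  move=> hr; apply: Rle_trans (sg_bound_le r (t + 1) _ ltac:(rlra) hr) _.
  rewrite /B (Rmult_assoc _ p); apply: Rmult_le_compat_l; last exact: Pp.
  by apply: Rmult_le_pos; [rlra | apply: Rlt_le; apply: exp_pos].
(* For [s < t] the argument [s - r] of [u] may be negative, but it stays above -1 because [s] is
   within 1 of [t]. The difference is then split into a change of integrand on [[0, t]] and a short
   integral between [t] and [s]. *)
have [c [c0 Hc]] := cts_bounded u (-1) 1 Hu.
have e1 : 0 < e / 2 / (B * (t + 1)) by apply: Rdiv_lt_0_compat; [rlra | apply: Rmult_lt_0_compat; rlra].
have [d1 [d10 H1]] := unif_cts u (-1) (t + 1) _ Hu e1.
have Bc : 0 < B * c by apply: Rmult_lt_0_compat.
have e2 : 0 < e / 2 / (B * c) by apply: Rdiv_lt_0_compat; rlra.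
exists (Rmin 1 (Rmin d1 (e / 2 / (B * c)))); split; first by apply: Rmin_pos; [rlra | apply: Rmin_pos].
move=> s hs.
have hs0 := Rlt_le_trans _ _ _ hs (Rmin_l _ _).
have hs1 := Rlt_le_trans _ _ _ hs (Rle_trans _ _ _ (Rmin_r _ _) (Rmin_l _ _)).
have hs2 := Rlt_le_trans _ _ _ hs (Rle_trans _ _ _ (Rmin_r _ _) (Rmin_r _ _)).
have st : -1 < s - t < 1 by move: hs0; split_Rabs; rlra.
rewrite -(integ_chasles (kernel u s) 0 t s); last exact: cts_kernel.
set I1 := integ _ 0 t; set I2 := integ _ t s; set I3 := integ _ 0 t.
have -> : minus (plus I1 I2) I3 = plus (minus I1 I3) I2 by vec Z.
have n1 : norm (minus I1 I3) <= (t - 0) * (B * (e / 2 / (B * (t + 1)))).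
  rewrite /I1 /I3 -integ_minus; try exact: cts_kernel.
  apply: norm_integ_const => //; first by apply: cts_minus; apply: cts_kernel.
  move=> r hr; have -> : minus (kernel u s r) (kernel u t r) =
      kernel (fun q => minus (u (q + s - t)) (u q)) t r.
    rewrite /kernel (linear_minus P) // (sg_minus _ _ _ HS).
    by have -> : t - r + s - t = s - r by ring.
  apply: Rle_trans (kB t _ r ltac:(rlra)) _; apply: Rmult_le_compat_l; first rlra.
  apply: Rlt_le; apply: H1; try rlra.
  by have -> : t - r + s - t - (t - r) = s - t by ring.
have n2 : norm I2 <= Rabs (s - t) * (B * c).
  apply: (@norm_RInt_le_const_abs (realify ZC) (kernel u s) t s).
    move=> r hr; apply: Rle_trans (kB _ _ _ _) _.
      by move: hr; rewrite /Rmin /Rmax; case: Rle_dec; rlra.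
    apply: Rmult_le_compat_l; first rlra; apply: Hc.
    by move: hr; rewrite /Rmin /Rmax; case: Rle_dec; rlra.
  by apply: cts_is_RInt; apply: cts_kernel.
have n3 : (t - 0) * (B * (e / 2 / (B * (t + 1)))) <= e / 2.
  have -> : (t - 0) * (B * (e / 2 / (B * (t + 1)))) = e / 2 * (t / (t + 1)) by field; rlra.
  rewrite -[X in _ <= X]Rmult_1_r; apply: Rmult_le_compat_l; first rlra.
  apply: (Rmult_le_reg_r (t + 1)); first rlra.
  by rewrite /Rdiv Rmult_assoc Rinv_l; rlra.
have n4 : Rabs (s - t) * (B * c) < e / 2.
  have := Rmult_lt_compat_r _ _ _ Bc hs2; have -> : e / 2 / (B * c) * (B * c) = e / 2; last by [].
  by field; split; apply: Rgt_not_eq.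
by apply: Rle_lt_trans (norm_triangle _ _) _; rlra.
Qed.

(** Bielecki's weight: in the supremum norm divided by [weight] the Volterra operator contracts on
    the whole time axis at once, so no gluing of local solutions is needed. *)
Definition weight t := exp (l * Rmax 0 t).

Lemma weight_pos t : 0 < weight t.
Proof. exact: exp_pos. Qed.

(** Relative to the weight at [t], the integrand decays like [exp (- (l - w) * s)]. Integration
    gives the factor [M * p / (l - w)], which is at most one half by the choice of [l]. *)
Lemma volterra_contraction u c : cts u -> (forall t, norm (u t) <= c * weight t) ->
  forall t, norm (volterra u t) <= c / 2 * weight t.
Proof.
move=> Hu uc t; rewrite /volterra /weight; move: (Rmax_l 0 t); move: (Rmax 0 t) => {}t t0.
have lw : 0 < l - w.
  by apply: Rlt_le_trans hl; apply: Rmult_lt_0_compat => //; rlra.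
have c0 : 0 <= c.
  have := uc 0; have := weight_pos 0; have := norm_ge_0 (u 0); rnra.
have W0 := exp_pos (l * t).
apply: Rle_trans (norm_integ_exp _ (l - w) (M * p * c * exp (l * t)) t (cts_kernel _ _ Hu) lw t0 _) _.
  move=> s hs; apply: Rle_trans (sg_bound _ _ _ HS s _ ltac:(rlra)) _.
  apply: Rle_trans (_ : M * exp (w * s) * (p * (c * exp (l * (t - s)))) <= _).
    apply: Rmult_le_compat_l; first by apply: Rmult_le_pos; [rlra | apply: Rlt_le; apply: exp_pos].
    apply: Rle_trans (Pp _) _; apply: Rmult_le_compat_l; first rlra.
    by have := uc (t - s); rewrite /weight Rmax_right; rlra.
  apply: Req_le.
  have -> : l * (t - s) = l * t + - (l - w) * s + - (w * s) by ring.
  rewrite !exp_plus exp_Ropp; field.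
  by apply: Rgt_not_eq; apply: exp_pos.
apply: (Rmult_le_reg_r (l - w)) => //.
rewrite /Rdiv Rmult_assoc Rinv_l; last rlra.
have := Rmult_le_compat_r (c * exp (l * t)) _ _ ltac:(apply: Rmult_le_pos; rlra) hl; rlra.
Qed.

(** Iterating the contraction gains a factor one half each time. Uniqueness holds among functions
    dominated by the weight, so every application has to supply a growth bound. *)
Lemma volterra_unique u c : cts u -> (forall t, norm (u t) <= c * weight t) ->
  (forall t, u t = volterra u t) -> forall t, u t = zero.
Proof.
move=> Hu uc ue t.
have c0 : 0 <= c.
  have := uc 0; have := weight_pos 0; have := norm_ge_0 (u 0); rnra.
have Hn n : forall t, norm (u t) <= c * (/2) ^ n * weight t.
  elim: n => [|n IH] s; first by rewrite Rmult_1_r.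
  rewrite ue; apply: Rle_trans (volterra_contraction _ _ Hu IH s) _.
  by apply: Req_le; rewrite [(/2) ^ n.+1]/=; field.
apply: norm_eq_zero; apply: Rle_antisym (norm_ge_0 _); apply: Rle_of_eps => e e0.
have W := weight_pos t.
have e1 : 0 < e / (c * weight t + 1).
  by apply: Rdiv_lt_0_compat => //; have : 0 <= c * weight t; [apply: Rmult_le_pos; rlra | rlra].
have [N /(_ N (Nat.le_refl _)) HN] := half_pow_small _ e1.
have := Hn N t; have cW : 0 <= c * weight t by apply: Rmult_le_pos; rlra.
have := Rmult_lt_compat_r (c * weight t + 1) _ _ ltac:(rlra) HN.
rewrite /Rdiv Rmult_assoc Rinv_l; last rlra.
have : 0 <= (/2) ^ N by apply: pow_le; rlra.
rnra.
Qed.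

(** Picard iteration. The limit is taken separately at each time; the weighted estimate makes the
    convergence locally uniform, whence continuity of the solution. *)
Lemma volterra_solution g c : cts g -> (forall t, norm (g t) <= c * weight t) ->
  exists u, cts u /\ (forall t, norm (u t) <= 2 * c * weight t) /\
    forall t, u t = plus (g t) (volterra u t).
Proof.
move=> Hg gc.
have c0 : 0 <= c.
  have := gc 0; have := weight_pos 0; have := norm_ge_0 (g 0); rnra.
pose s := fix s n : R -> Z := match n with
  O => g | Datatypes.S n => fun t => plus (g t) (volterra (s n) t) end.
have Hs n : cts (s n).
  by elim: n => [|n IH] //; apply: cts_plus => //; apply: cts_volterra.
have sS n t : s n.+1 t = plus (g t) (volterra (s n) t) by [].
have Hd n : forall t, norm (minus (s n.+1 t) (s n t)) <= c / 2 * (/2) ^ n * weight t.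
  elim: n => [|n IH] t.
    rewrite Rmult_1_r; apply: Rle_trans (volterra_contraction _ _ Hg gc t); apply: Req_le.
    by congr norm; rewrite sS /=; vec Z.
  have -> : minus (s n.+2 t) (s n.+1 t) = volterra (fun t => minus (s n.+1 t) (s n t)) t.
    by rewrite volterra_minus // sS [X in minus _ X]sS; vec Z.
  apply: Rle_trans (volterra_contraction _ _ _ IH t) _; first exact: cts_minus.
  by apply: Req_le; rewrite [(/2) ^ n.+1]/=; field.
have lim t : exists x : Z, forall n, norm (minus x (s n t)) <= c * weight t * (/2) ^ n.
  have [n|x Hx] := geometric_lim (fun n => s n t) (c / 2 * weight t).
    by apply: Rle_trans (Hd n t) _; apply: Req_le; ring.
  by exists x => n; apply: Rle_trans (Hx n) _; apply: Req_le; field.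
have [u Hu] := choice _ lim.
have uc : cts u.
  move=> t; apply/continuous_eps => e e0.
  have W (r : R) : Rabs (r - t) < 1 -> weight r <= weight (Rabs t + 1).
    move=> hr; apply: exp_le; apply: Rmult_le_compat_l.
      have : 0 <= 2 * M * p; [apply: Rmult_le_pos; rlra | rlra].
    rewrite (Rmax_right 0 (Rabs t + 1)); last by have := Rabs_pos t; rlra.
    apply: Rmax_lub; first by have := Rabs_pos t; rlra.
    by have := Rle_abs t; have := Rle_abs (r - t); rlra.
  set W0 := weight (Rabs t + 1) in W.
  have W00 : 0 < W0 := weight_pos _.
  have cW : 0 <= c * W0 by apply: Rmult_le_pos; rlra.
  have e1 : 0 < e / (3 * (c * W0 + 1)) by apply: Rdiv_lt_0_compat; rlra.
  have [N /(_ N (Nat.le_refl _)) HN] := half_pow_small _ e1.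
  have hN : c * W0 * (/2) ^ N < e / 3.
    have := Rmult_lt_compat_r (c * W0 + 1) _ _ ltac:(rlra) HN.
    have -> : e / (3 * (c * W0 + 1)) * (c * W0 + 1) = e / 3 by field; rlra.
    have : 0 <= (/2) ^ N by apply: pow_le; rlra.
    rlra.
  have hb (r : R) : Rabs (r - t) < 1 -> norm (minus (u r) (s N r)) < e / 3.
    move=> hr; apply: Rle_lt_trans hN; apply: Rle_trans (Hu r N) _.
    apply: Rmult_le_compat_r; first by apply: pow_le; rlra.
    by apply: Rmult_le_compat_l => //; apply: W.
  have [d [d0 Hd']] := proj1 (continuous_eps _ t) (Hs N t) (e / 3) ltac:(rlra).
  exists (Rmin 1 d); split; first by apply: Rmin_pos; rlra.
  move=> r hr.
  have h1 := hb r (Rlt_le_trans _ _ _ hr (Rmin_l _ _)).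
  have h2 := Hd' r (Rlt_le_trans _ _ _ hr (Rmin_r _ _)).
  have h3 := hb t ltac:(rewrite Rminus_diag Rabs_R0; rlra).
  have h4 := norm_minus_triangle (u r) (s N r) (u t).
  have h5 := norm_minus_triangle (s N r) (s N t) (u t).
  by rewrite (norm_minus_sym (s N t)) in h5; rlra.
exists u; split=> //; split.
  move=> t; have := norm_le_minus (u t) (g t); have := Hu t O; have := gc t.
  by rewrite /= Rmult_1_r; rlra.
move=> t; apply: eq_of_norm_le => e e0.
have W := weight_pos t; have cW : 0 <= c * weight t by apply: Rmult_le_pos; rlra.
have e1 : 0 < e / (2 * (c * weight t + 1)) by apply: Rdiv_lt_0_compat; rlra.
have [N /(_ N (Nat.le_refl _)) HN] := half_pow_small _ e1.
have h2 : norm (volterra (fun t => minus (u t) (s N t)) t) <= c * (/2) ^ N / 2 * weight t.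
  apply: volterra_contraction => [|r]; first exact: cts_minus.
  by apply: Rle_trans (Hu r N) _; apply: Req_le; ring.
rewrite volterra_minus // in h2.
have -> : minus (u t) (plus (g t) (volterra u t)) =
    minus (minus (u t) (s N.+1 t)) (minus (volterra u t) (volterra (s N) t)).
  by rewrite sS; vec Z.
apply: Rle_trans (norm_minus_le _ _) _.
have h1 := Hu t N.+1; rewrite [(/2) ^ N.+1]/= in h1.
have := Rmult_lt_compat_r (2 * (c * weight t + 1)) _ _ ltac:(rlra) HN.
rewrite /Rdiv Rmult_assoc Rinv_l; last rlra.
have : 0 <= (/2) ^ N by apply: pow_le; rlra.
rlra.
Qed.

Lemma orbit_weight x t : norm (S t x) <= M * norm x * weight t.
Proof.
rewrite (sg_max _ _ _ HS); apply: Rle_trans (sg_bound _ _ _ HS _ x (Rmax_l 0 t)) _.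
rewrite /weight Rmult_assoc (Rmult_comm (exp _)) -Rmult_assoc.
apply: Rmult_le_compat_l; first by apply: Rmult_le_pos; [rlra | exact: norm_ge_0].
apply: exp_le; apply: Rmult_le_compat_r; first exact: Rmax_l.
by have : 0 <= 2 * M * p; [apply: Rmult_le_pos; rlra | rlra].
Qed.

Lemma perturbed_orbit_ex x : exists u, cts u /\ (forall t, norm (u t) <= 2 * (M * norm x) * weight t) /\
  forall t, u t = plus (S t x) (volterra u t).
Proof.
by apply: volterra_solution => [|t]; [exact: sg_cts HS x | exact: orbit_weight].
Qed.

Lemma perturbed_orbit_unique x u v c d :
  cts u -> (forall t, norm (u t) <= c * weight t) ->
  (forall t, u t = plus (S t x) (volterra u t)) ->
  cts v -> (forall t, norm (v t) <= d * weight t) ->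
  (forall t, v t = plus (S t x) (volterra v t)) -> forall t, u t = v t.
Proof.
move=> uc ub ue vc vb ve t; apply: (plus_reg_r (opp (v t))); rewrite plus_opp_r.
apply: (volterra_unique (fun t => minus (u t) (v t)) (c + d)) => [|s|s].
- exact: cts_minus.
- by apply: Rle_trans (norm_minus_le _ _) _; have := ub s; have := vb s; rlra.
- by rewrite volterra_minus // {1}ue {1}ve; vec Z.
Qed.

(** The convolution is cut at [r = t]. The translate by [s] of a solution thereby solves the
    equation with initial value [u s], so that uniqueness yields the semigroup law. *)
Lemma volterra_shift u s t : cts u -> 0 <= s -> 0 <= t ->
  volterra u (t + s) = plus (S t (volterra u s)) (volterra (fun r => u (Rmax 0 r + s)) t).
Proof.
move=> Hu s0 t0; rewrite /volterra !Rmax_right //; last rlra.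
have Hk := cts_kernel u (t + s) Hu.
rewrite -(integ_chasles _ 0 t (t + s) Hk) plus_comm; congr plus.
  rewrite -(integ_linear (S t)); [|exact: sg_linear HS t|exact: cts_kernel].
  have -> : integ (kernel u (t + s)) t (t + s) = integ (kernel u (t + s)) (0 + t) (s + t).
    by congr integ; ring.
  rewrite -integ_shift //; apply: integ_ext => // r hr.
  rewrite /kernel -(sg_add _ _ _ HS) //; last rlra.
  by rewrite (Rplus_comm r); congr (S _ (P (u _))); ring.
apply: integ_ext => // r hr; rewrite /kernel Rmax_right; last rlra.
by congr (S _ (P (u _))); ring.
Qed.

(** The Volterra term has a right derivative at 0 for every continuous [u], so perturbed and
    unperturbed orbits are differentiable at 0 for the same initial values. *)
Lemma volterra_mean u : cts u ->
  filterlim (fun h => rs (/ h) (volterra u h)) (at_right 0) (locally (P (u 0))).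
Proof.
move=> Hu; apply/right_lim_eps => e e0.
have Hc : cts (fun r => S r (P (u 0))) := sg_cts _ _ _ HS _.
set B := M * exp (w * 1) * p.
have B0 : 0 < B by apply: Rmult_lt_0_compat => //; apply: Rmult_lt_0_compat; [rlra | exact: exp_pos].
have eB : 0 < e / 4 / B by apply: Rdiv_lt_0_compat; rlra.
have [d1 [d10 H1]] := proj1 (continuous_eps _ 0) (Hc 0) (e / 4) ltac:(rlra).
have [d2 [d20 H2]] := proj1 (continuous_eps _ 0) (Hu 0) _ eB.
exists (Rmin 1 (Rmin d1 d2)); split; first by apply: Rmin_pos; [rlra | apply: Rmin_pos].
move=> h [h0 hh].
have hh0 := Rlt_le_trans _ _ _ hh (Rmin_l _ _).
have hh1 := Rlt_le_trans _ _ _ hh (Rle_trans _ _ _ (Rmin_r _ _) (Rmin_l _ _)).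
have hh2 := Rlt_le_trans _ _ _ hh (Rle_trans _ _ _ (Rmin_r _ _) (Rmin_r _ _)).
have n1 : norm (minus (volterra u h) (rs (h - 0) (P (u 0)))) <= (h - 0) * (e / 2).
  rewrite /volterra Rmax_right; last rlra.
  apply: integ_approx; [exact: cts_kernel | rlra | move=> r hr].
  apply: Rle_trans (norm_minus_triangle _ (S r (P (u 0))) _) _.
  have := H1 r ltac:(rewrite Rabs_pos_eq; rlra); rewrite (sg_zero _ _ _ HS).
  have : norm (minus (kernel u h r) (S r (P (u 0)))) <= e / 4; last rlra.
  rewrite /kernel -(sg_minus _ _ _ HS) -(linear_minus P) //.
  apply: Rle_trans (sg_bound_le r 1 _ ltac:(rlra) ltac:(rlra)) _.
  have -> : e / 4 = M * exp (w * 1) * (p * (e / 4 / B)).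
    by transitivity (B * (e / 4 / B)); [field; rlra | rewrite /B; ring].
  apply: Rmult_le_compat_l; first by apply: Rmult_le_pos; [rlra | apply: Rlt_le; apply: exp_pos].
  apply: Rle_trans (Pp _) _; apply: Rmult_le_compat_l; first rlra.
  by apply: Rlt_le; apply: H2; rewrite Rabs_pos_eq; rlra.
have -> : minus (rs (/ h) (volterra u h)) (P (u 0)) =
    rs (/ h) (minus (volterra u h) (rs (h - 0) (P (u 0)))).
  by vec Z; field; rlra.
rewrite norm_rs Rabs_pos_eq; last by apply: Rlt_le; apply: Rinv_0_lt_compat.
apply: Rle_lt_trans (_ : / h * (h * (e / 2)) < e).
  by apply: Rmult_le_compat_l; [apply: Rlt_le; apply: Rinv_0_lt_compat | rlra].
by rewrite -Rmult_assoc Rinv_l; rlra.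
Qed.

(** Linearity in the initial value and the semigroup law follow from uniqueness, both sides solving
    the same Volterra equation. The constants [2 * M] and [l] are those of the weighted bound on
    solutions. *)
Lemma perturbed_semigroup : exists T, semigroup T (2 * M) l /\
  forall x y, gen T x (plus y (P x)) <-> gen S x y.
Proof.
have l0 : 0 <= l by have : 0 <= 2 * M * p; [apply: Rmult_le_pos; rlra | rlra].
have [W HW] := choice _ perturbed_orbit_ex.
have Wc x : cts (W x) by case: (HW x).
have Wb x t : norm (W x t) <= 2 * (M * norm x) * weight t by case: (HW x) => _ [].
have We x t : W x t = plus (S t x) (volterra (W x) t) by case: (HW x) => _ [].
have vmax u t : volterra u (Rmax 0 t) = volterra u t.
  by rewrite /volterra (Rmax_right 0 (Rmax 0 t)) //; apply: Rmax_l.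
have v0 u : volterra u 0 = zero by rewrite /volterra Rmax_left ?integ_point //; rlra.
have W0 x : W x 0 = x by rewrite We v0 (sg_zero _ _ _ HS) plus_zero_r.
have Wmax t x : W x t = W x (Rmax 0 t) by rewrite We -vmax (sg_max _ _ _ HS) -We.
have uniq x v d := perturbed_orbit_unique x (W x) v _ d (Wc x) (Wb x) (We x).
exists (fun t x => W x t); split; last first.
  move=> x y; have HV := volterra_mean _ (Wc x); rewrite W0 in HV.
  have HV' := lim_linear _ _ _ is_linear_opp HV.
  split=> H.
    have -> : y = plus (plus y (P x)) (opp (P x)) by vec Z.
    apply: (right_lim_ext _ _ _ _ (lim_plus _ _ _ _ H HV')) => h hh.
    by rewrite We; vec Z.
  apply: (right_lim_ext _ _ _ _ (lim_plus _ _ _ _ H HV)) => h hh.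
  by rewrite We; vec Z.
split=> //; try rlra.
- move=> t; split.
  + move=> x y; apply: (uniq _ (fun t => plus (W x t) (W y t))
      (2 * (M * norm x) + 2 * (M * norm y))) => [|s|s].
    * exact: cts_plus.
    * by apply: Rle_trans (norm_triangle _ _) _; have := Wb x s; have := Wb y s; rlra.
    * by rewrite volterra_plus // {1}We {1}(We y) (sg_plus _ _ _ HS); vec Z.
  + move=> a x; apply: (uniq _ (fun t => scal a (W x t)) (abs a * (2 * (M * norm x)))) => [|s|s].
    * exact: cts_linear (is_linear_scal a) (Wc x).
    * apply: Rle_trans (norm_scal _ _) _; rewrite Rmult_assoc.
      by apply: Rmult_le_compat_l; [exact: abs_ge_0 | exact: Wb].
    * by rewrite volterra_scal // {1}We scal_distr_l (linear_scal _ (sg_linear _ _ _ HS s)).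
  + exists (2 * M * weight t); split.
      by apply: Rmult_lt_0_compat; [rlra | exact: weight_pos].
    by move=> x; apply: Rle_trans (Wb x t) _; apply: Req_le; ring.
- move=> s t x s0 t0.
  have -> : W x (t + s) = W x (Rmax 0 t + s) by rewrite Rmax_right.
  apply: esym; apply: (uniq _ (fun t => W x (Rmax 0 t + s)) (2 * (M * norm x) * exp (l * s))) => [|r|r].
  + exact: (cts_Rmax0 (fun t => W x (t + s)) (cts_shift _ _ (Wc x))).
  + apply: Rle_trans (Wb x _) _; rewrite /weight Rmax_right; last by have := Rmax_l 0 r; rlra.
    by rewrite Rmult_plus_distr_l exp_plus; apply: Req_le; ring.
  + rewrite -(vmax _ r) (sg_max _ _ _ HS r).
    move: (Rmax 0 r) (Rmax_l 0 r) => {}r r0.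
    rewrite We volterra_shift // (sg_add _ _ _ HS) // plus_assoc; congr plus.
    by rewrite -(sg_plus _ _ _ HS) -We.
- move=> t x t0; apply: Rle_trans (Wb x t) _; rewrite /weight Rmax_right //.
  by apply: Req_le; ring.
Qed.

End BoundedPerturbation.

(** * Perturbations bounded on the domain *)

Section DomainPerturbation.
Context {k : scalars}.
Local Notation K := (field_of k).
Context {ZC : CompleteNormedModule K}.
Local Notation Z := (CompleteNormedModule.NormedModule K ZC).
Implicit Types (S T : R -> Z -> Z) (x y z : Z) (s t h : R).

Definition generated (G : Z -> Z -> Prop) : Prop :=
  exists S M w, semigroup S M w /\ forall x y, G x y <-> gen S x y.

Lemma generated_C0 (G : Z -> Z -> Prop) : generated G -> @generates_C0_semigroup k Z G.
Proof. by move=> [S [M [w [HS HG]]]]; exists S; split; [exact: semigroup_C0 HS | exact: HG]. Qed.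

Lemma C0_generated (G : Z -> Z -> Prop) : @generates_C0_semigroup k Z G -> generated G.
Proof.
move=> [S [HS HG]]; have [T [M [w [HT TS]]]] := C0_normalize _ HS.
exists T, M, w; split=> // x y; split=> [/HG|H]; last apply/HG.
  by apply: gen_ext => t t0; rewrite TS //; apply: Rlt_le.
by apply: gen_ext H => t t0; rewrite TS //; apply: Rlt_le.
Qed.

Definition perturbed (G : Z -> Z -> Prop) (P : Z -> Z) x z := exists y, G x y /\ z = plus y (P x).

Lemma bounded_perturbation G P : generated G -> is_linear P -> generated (perturbed G P).
Proof.
move=> [S [M [w [HS HG]]]] HP; have [p [p0 Hp]] := linear_norm _ HP.
have [T [HT Hgen]] := perturbed_semigroup S M w P p (w + 2 * M * p) HS HP p0 Hp ltac:(rlra).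
exists T, (2 * M), (w + 2 * M * p); split=> // x z; split.
  by move=> [y [/HG H ->]]; apply/Hgen.
move=> H; exists (minus z (P x)); split; last by vec Z.
by apply/HG/Hgen; have -> : plus (minus z (P x)) (P x) = z by vec Z.
Qed.

Lemma semigroup_conj S M w (U V : Z -> Z) : semigroup S M w -> is_linear U -> is_linear V ->
  (forall x, U (V x) = x) -> (forall x, V (U x) = x) ->
  exists M', semigroup (fun t x => U (S t (V x))) M' w.
Proof.
move=> HS HU HV UV VU.
have [a [a0 Ha]] := linear_norm _ HU; have [b [b0 Hb]] := linear_norm _ HV.
have M1 := sg_M _ _ _ HS.
exists (Rmax 1 (a * M * b)); split.
- move=> t; exact: (is_linear_comp _ _ HV (is_linear_comp _ _ (sg_linear _ _ _ HS t) HU)).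
- by move=> x; rewrite (sg_zero _ _ _ HS) UV.
- by move=> s t x s0 t0; rewrite VU (sg_add _ _ _ HS).
- by move=> x; apply: cts_linear => //; apply: sg_cts HS _.
- by move=> t x; rewrite (sg_max _ _ _ HS).
- exact: Rmax_l.
- exact: sg_w HS.
- move=> t x t0; apply: Rle_trans (Ha _) _.
  have E := exp_pos (w * t).
  apply: Rle_trans (_ : a * (M * exp (w * t) * (b * norm x)) <= _).
    apply: Rmult_le_compat_l; first rlra.
    apply: Rle_trans (sg_bound _ _ _ HS t _ t0) _.
    by apply: Rmult_le_compat_l; [apply: Rmult_le_pos; rlra | exact: Hb].
  have -> : a * (M * exp (w * t) * (b * norm x)) = a * M * b * exp (w * t) * norm x by ring.
  apply: Rmult_le_compat_r; first exact: norm_ge_0.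
  by apply: Rmult_le_compat_r; [rlra | exact: Rmax_r].
Qed.

Lemma gen_conj S (U V : Z -> Z) : is_linear U -> is_linear V ->
  (forall x, U (V x) = x) -> (forall x, V (U x) = x) ->
  forall x y, gen (fun t x => U (S t (V x))) x y <-> gen S (V x) (V y).
Proof.
move=> HU HV UV VU x y; split=> H.
  apply: (right_lim_ext _ _ _ _ (lim_linear _ _ _ HV H)) => h hh.
  by rewrite (linear_rs V) // (linear_minus V) // VU.
rewrite -(UV y); apply: (right_lim_ext _ _ _ _ (lim_linear _ _ _ HU H)) => h hh.
by rewrite (linear_rs U) // (linear_minus U) // UV.
Qed.

(** The Neumann series is applied to the square of [L]: if [u - L (L u) = y], then [u + L u] is the
    preimage of [y] under [I - L]. A fixed point of [L] is one of its square, which gives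
    injectivity. *)
Lemma inverse_one_minus (L : Z -> Z) :
  is_linear L -> (forall x, norm (L (L x)) <= /2 * norm x) ->
  exists V : Z -> Z, is_linear V /\ (forall y, minus (V y) (L (V y)) = y) /\
    forall x, V (minus x (L x)) = x.
Proof.
move=> HL HLL; have [m [m0 Hm]] := linear_norm _ HL.
have ex y : exists x, minus x (L x) = y /\ norm x <= (1 + m) * 2 * norm y.
  have [u [Hu nu]] := neumann (fun x => L (L x)) (is_linear_comp _ _ HL HL) HLL y.
  exists (plus u (L u)); split; first by rewrite (linear_plus L) // -Hu; vec Z.
  apply: Rle_trans (norm_triangle _ _) _; have := Hm u.
  by have := Rmult_le_compat_l (1 + m) _ _ ltac:(rlra) nu; rlra.
have inj x x' : minus x (L x) = minus x' (L x') -> x = x'.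
  move=> H; have Hd : L (minus x x') = minus x x'.
    rewrite (linear_minus L) //; apply: (plus_reg_r (opp (minus (L x) (L x')))).
    have -> : plus (minus x x') (opp (minus (L x) (L x'))) =
      minus (minus x (L x)) (minus x' (L x')) by vec Z.
    by rewrite H; vec Z.
  apply: eq_of_norm_le => e e0; have := HLL (minus x x'); rewrite !Hd.
  by have := norm_ge_0 (minus x x'); rlra.
have [V HV] := choice _ ex.
have VE y : minus (V y) (L (V y)) = y by case: (HV y).
exists V; split; last by split=> // x; apply: inj; rewrite VE.
split.
- move=> x y; apply: inj; rewrite VE (linear_plus L) // -{1}(VE x) -{1}(VE y); vec Z.
- move=> a x; apply: inj; rewrite VE (linear_scal L) // -{1}(VE x) scal_minus //.
exists ((1 + m) * 2); split; first by apply: Rmult_lt_0_compat; rlra.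
by move=> y; case: (HV y).
Qed.

(* For large l put L = B (l - A)^-1; then L^2 is small because B is bounded for
   the graph norm, so U = I - L is invertible, and A + B = U (A + (l - A) L) U^-1
   is similar to a bounded perturbation of A. *)
Lemma domain_perturbation (G : Z -> Z -> Prop) (B : Z -> Z) (N : R) : generated G ->
  (forall x y x' y', G x y -> G x' y' -> B (plus x x') = plus (B x) (B x')) ->
  (forall a x y, G x y -> B (scal a x) = scal a (B x)) ->
  (forall x y, G x y -> exists z, G (B x) z /\ norm (B x) + norm z <= N * (norm x + norm y)) ->
  generated (perturbed G B).
Proof.
move=> HG0; have [S [M [w [HS HG]]]] := HG0; move=> Badd Bscal BD.
have M1 := sg_M _ _ _ HS; have w0 := sg_w _ _ _ HS.
wlog N0 : N BD / 0 <= N.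
  move/(_ (Rabs N)); apply; last exact: Rabs_pos.
  move=> x y /BD [z [Hz Nz]]; exists z; split=> //; apply: Rle_trans Nz _.
  apply: Rmult_le_compat_r; last exact: Rle_abs.
  by have := norm_ge_0 x; have := norm_ge_0 y; rlra.
(* [2 * w] makes [l - w] at least [w], so that [c * l <= 4 * M] independently of [w]. The first term
   of [D] admits the resolvent and gives [c <= 1]; the second is what [NNc] needs. *)
pose D := 2 * M + 4 * N * N * M * (4 * M + 2); pose l := 2 * w + D.
have D1 : 0 <= 4 * N * N * M * (4 * M + 2).
  by repeat apply: Rmult_le_pos => //; rlra.
have [Q [HQ [QD [Qinv Qb]]]] := resolvent S M w l HS ltac:(rewrite /l /D; rlra).
pose c := 2 * M / (l - w).
have lw : 0 < l - w by rewrite /l /D; rlra.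
have c0 : 0 < c by apply: Rdiv_lt_0_compat; rlra.
have cl : c * (l - w) = 2 * M by rewrite /c; field; rlra.
have c1 : c <= 1.
  by apply: (Rmult_le_reg_r (l - w)) => //; rewrite cl /l /D; rlra.
have lc : c * l <= 4 * M.
  have : c * w <= c * (l - w) by apply: Rmult_le_compat_l; [rlra | rewrite /l /D; rlra].
  by rlra.
have NNc : N * N * c * (4 * M + 2) <= /2.
  apply: (Rmult_le_reg_r (l - w)) => //.
  have -> : N * N * c * (4 * M + 2) * (l - w) = N * N * (4 * M + 2) * (c * (l - w)) by ring.
  by rewrite cl /l /D; rlra.
pose L x := B (Q x).
have GQ y : G (Q y) (minus (rs l (Q y)) y) by apply/HG.
have Gu x y y' : G x y -> G x y' -> y = y' by move=> /HG H /HG; apply: gen_unique H.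
have Gp x y x' y' : G x y -> G x' y' -> G (plus x x') (plus y y').
  by move=> /HG H /HG H'; apply/HG; apply: gen_plus (sg_linear _ _ _ HS) H H'.
have Gm x y x' y' : G x y -> G x' y' -> G (minus x x') (minus y y').
  by move=> /HG H /HG H'; apply/HG; apply: gen_minus (sg_linear _ _ _ HS) H H'.
have Gs a x y : G x y -> G (scal a x) (scal a y).
  by move=> /HG H; apply/HG; apply: gen_scal (sg_linear _ _ _ HS) H.
have GQl x y : G x y -> Q (minus (rs l x) y) = x by move=> /HG; apply: Qinv.
have Qc y : norm (Q y) <= c * norm y by apply: Qb.
have AQ y : norm (Q y) + norm (minus (rs l (Q y)) y) <= (4 * M + 2) * norm y.
  have n0 := norm_ge_0 y; have h := Qc y.
  have h1 : norm (rs l (Q y)) <= c * l * norm y.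
    rewrite norm_rs Rabs_pos_eq; last by rewrite /l /D; rlra.
    have := Rmult_le_compat_l l _ _ ltac:(rewrite /l /D; rlra) h; rlra.
  have := norm_minus_le (rs l (Q y)) y.
  have := Rmult_le_compat_r _ _ _ n0 lc; have := Rmult_le_compat_r _ _ _ n0 c1; rlra.
(* [L] takes values in the domain of the generator, and [AL] is the generator after [L]; it is
   bounded because [L] is bounded into the graph norm. *)
have [AL HAL] : exists AL : Z -> Z, forall y,
    G (L y) (AL y) /\ norm (L y) + norm (AL y) <= N * (4 * M + 2) * norm y.
  apply: (choice (fun y z => G (L y) z /\ norm (L y) + norm z <= N * (4 * M + 2) * norm y)) => y.
  have [z [Hz Nz]] := BD _ _ (GQ y); exists z; split=> //.
  by apply: Rle_trans Nz _; rewrite Rmult_assoc; apply: Rmult_le_compat_l => //; apply: AQ.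
have NM : 0 <= N * (4 * M + 2) by apply: Rmult_le_pos; rlra.
have HL : is_linear L.
  split.
  - by move=> x y; rewrite /L (linear_plus Q) // (Badd _ _ _ _ (GQ x) (GQ y)).
  - by move=> a x; rewrite /L (linear_scal Q) // (Bscal _ _ _ (GQ x)).
  exists (N * (4 * M + 2) + 1); split; first rlra.
  by move=> x; have [_] := HAL x; have := norm_ge_0 (AL x); have := norm_ge_0 x; rlra.
have HALl : is_linear AL.
  split.
  - move=> x y; apply: Gu (Gp _ _ _ _ (proj1 (HAL x)) (proj1 (HAL y))).
    by rewrite -(linear_plus L) //; case: (HAL (plus x y)).
  - move=> a x; apply: Gu (Gs a _ _ (proj1 (HAL x))).
    by rewrite -(linear_scal L) //; case: (HAL (scal a x)).
  exists (N * (4 * M + 2) + 1); split; first rlra.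
  by move=> x; have [_] := HAL x; have := norm_ge_0 (L x); have := norm_ge_0 x; rlra.
(* On the domain [Q] commutes with the generator, hence shrinks graph norms by the factor [c]. Since
   [L x] lies in the domain, the outer [L] gains this factor. *)
have HLL x : norm (L (L x)) <= /2 * norm x.
  have [GL NL] := HAL x.
  have e1 : minus (rs l (Q (L x))) (L x) = Q (AL x).
    have := GQl _ _ GL; rewrite (linear_minus Q) // (linear_rs Q) // => H.
    by rewrite -[X in minus _ X = _]H; vec Z.
  have [z [_ Nz]] := BD _ _ (GQ (L x)); rewrite e1 in Nz.
  have h1 := Qc (L x); have h2 := Qc (AL x).
  have n0 := norm_ge_0 z; have nx := norm_ge_0 x.
  have h3 : norm (Q (L x)) + norm (Q (AL x)) <= c * (N * (4 * M + 2) * norm x).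
    have := Rmult_le_compat_l c _ _ ltac:(rlra) NL; rlra.
  have h4 := Rmult_le_compat_l _ _ _ N0 h3.
  have h5 := Rmult_le_compat_r _ _ _ nx NNc.
  have : norm (L (L x)) <= norm (B (Q (L x))) by apply: Rle_refl.
  rlra.
pose P x := minus (rs l (L x)) (AL x).
have HP : is_linear P.
  by apply: is_linear_sub => //; apply: is_linear_comp (is_linear_rs l).
have [T [M' [w' [HT TG]]]] := bounded_perturbation G P HG0 HP.
have [V [HV [VE EV]]] := inverse_one_minus L HL HLL.
have HU : is_linear (fun x => minus x (L x)) by apply: is_linear_sub => //; apply: is_linear_id.
have [M2 HT'] := semigroup_conj T M' w' _ V HT HU HV VE EV.
exists (fun t x => minus (T t (V x)) (L (T t (V x)))), M2, w'; split=> // x z.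
(* With [U = I - L], this is the similarity in the form used in both directions: substitute
   [B x = L (l x - y)] and [x = U (V x)]. The summand [AL (V x)], which passes between [x] and
   [V x], cancels against the one in [P]. *)
have key y : G x y -> plus y (B x) =
    minus (plus y (rs l (L (V x)))) (L (plus y (rs l (L (V x))))).
  move=> /GQl H; have {1}-> : B x = L (minus (rs l x) y) by rewrite /L H.
  rewrite -{1}(VE x) (linear_plus L) // !(linear_minus L) // !(linear_rs L) // (linear_minus L) //.
  by vec Z.
have GV := HAL (V x).
split.
  move=> [y [Hy ->]]; apply/(gen_conj T _ V HU HV VE EV)/TG.
  exists (plus y (AL (V x))); split.
    have e : plus x (L (V x)) = V x by rewrite -{1}(VE x); vec Z.
    by rewrite -{1}e; apply: Gp => //; case: GV.
  by rewrite (key y Hy) EV /P; vec Z.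
move=> /(gen_conj T _ V HU HV VE EV)/TG [y [Hy HVz]].
have Hx : G x (minus y (AL (V x))) by rewrite -{1}(VE x); apply: Gm => //; case: GV.
exists (minus y (AL (V x))); split=> //; rewrite (key _ Hx).
have -> : plus (minus y (AL (V x))) (rs l (L (V x))) = V z by rewrite HVz /P; vec Z.
by rewrite VE.
Qed.

End DomainPerturbation.

(** * Derivatives and reversible groups *)

Section Derivative.
Context {k : scalars}.
Local Notation K := (field_of k).
Context {ZC : CompleteNormedModule K}.
Local Notation Z := (CompleteNormedModule.NormedModule K ZC).
Implicit Types (f : R -> Z) (x y z : Z) (s t h : R).

Definition derives f t (y : Z) : Prop := @is_derive R_AbsRing (realify ZC) f t y.

Lemma derives_eps f t y :
  (forall e, 0 < e -> exists d, 0 < d /\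
    forall h, Rabs h < d -> norm (minus (minus (f (t + h)) (f t)) (rs h y)) <= e * Rabs h) ->
  derives f t y.
Proof.
move=> H; split; first exact: (is_linear_scal_l (K := R_AbsRing) (V := realify ZC) y).
move=> t' Ht'; have -> : t' = t.
  by apply: esym; apply: (is_filter_lim_locally_unique (V := R_NormedModule)).
move=> e; have [d [d0 Hd]] := H e (cond_pos e); exists (mkposreal d d0) => s st.
have := Hd (s - t) st; have -> : t + (s - t) = s by ring.
exact.
Qed.

Lemma derives_bound f t y e : derives f t y -> 0 < e -> exists d, 0 < d /\
  forall h, Rabs h < d -> norm (minus (minus (f (t + h)) (f t)) (rs h y)) <= e * Rabs h.
Proof.
move=> [_ H] e0; have [d Hd] := H t (fun P HP => HP) (mkposreal e e0).
exists d; split; first exact: cond_pos.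
move=> h hd; have ht : (t + h) - t = h by ring.
have Hb : ball t d (t + h) by change (Rabs ((t + h) - t) < d); rewrite ht.
have := Hd _ Hb.
change (norm (minus (minus (f (t + h)) (f t)) (rs (t + h - t) y)) <= e * Rabs (t + h - t) ->
  norm (minus (minus (f (t + h)) (f t)) (rs h y)) <= e * Rabs h).
by rewrite ht.
Qed.

Lemma derives_right f t y : derives f t y ->
  filterlim (fun h => rs (/ h) (minus (f (t + h)) (f t))) (at_right 0) (locally y).
Proof.
move=> H; apply/right_lim_eps => e e0.
have [d [d0 Hd]] := derives_bound f t y (e / 2) H ltac:(rlra).
exists d; split=> // h hh; have := Hd h; rewrite Rabs_pos_eq; last rlra.
have -> : minus (rs (/ h) (minus (f (t + h)) (f t))) y =
    rs (/ h) (minus (minus (f (t + h)) (f t)) (rs h y)) by vec Z; field; rlra.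
have h1 : 0 < / h by apply: Rinv_0_lt_compat; rlra.
rewrite norm_rs Rabs_pos_eq; last rlra.
move=> /(_ ltac:(rlra)) /(Rmult_le_compat_l (/ h) _ _ (Rlt_le _ _ h1)).
have -> : / h * (e / 2 * h) = e / 2 by field; rlra.
rlra.
Qed.

Lemma derives_unique f t y y' : derives f t y -> derives f t y' -> y = y'.
Proof.
move=> /derives_right H /derives_right H'; exact: (filterlim_locally_unique _ _ _ H H').
Qed.

Lemma derives_ext f g t y : (forall s, f s = g s) -> derives f t y -> derives g t y.
Proof. move=> fg; exact: is_derive_ext. Qed.

(* The set of s with |f r - f 0| <= e r for all r in [0, s] is closed, and the
   vanishing right derivative lets it be extended beyond its supremum. *)
Lemma right_derivative_zero f : cts f ->
  (forall t, 0 <= t ->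
    filterlim (fun h => rs (/ h) (minus (f (t + h)) (f t))) (at_right 0) (locally (zero : Z))) ->
  forall t, 0 <= t -> f t = f 0.
Proof.
move=> Hf Hd t1 t10; apply: eq_of_norm_le => e0 e00.
pose e := e0 / (t1 + 1); have ep : 0 < e by apply: Rdiv_lt_0_compat; rlra.
suff H : norm (minus (f t1) (f 0)) <= e * t1.
  apply: Rle_trans H _; have -> : e0 = e * (t1 + 1) by rewrite /e; field; rlra.
  rlra.
apply: Rnot_lt_le => bad.
pose A s := 0 <= s <= t1 /\ forall r, 0 <= r <= s -> norm (minus (f r) (f 0)) <= e * r.
have A0 : A 0.
  split; first rlra; move=> r hr; have -> : r = 0 by rlra.
  by rewrite /minus plus_opp_r norm_zero; rlra.
have [m [Hub Hlub]] := completeness A (ex_intro _ t1 (fun s Hs => proj2 (proj1 Hs))) (ex_intro _ 0 A0).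
have m0 : 0 <= m by apply: Hub.
have mt : m <= t1 by apply: Hlub => s [] [].
have below r : 0 <= r < m -> norm (minus (f r) (f 0)) <= e * r.
  move=> hr; apply: Rnot_lt_le => hbad; have : m <= r; last rlra.
  apply: Hlub => s [hs Hs]; apply: Rnot_lt_le => rs'.
  by have := Hs r ltac:(rlra); rlra.
have at_m : norm (minus (f m) (f 0)) <= e * m.
  case: (Req_dec m 0) => [->|mn]; first by rewrite /minus plus_opp_r norm_zero; rlra.
  apply: Rle_of_eps => d d0.
  have [c [c0 Hc]] := proj1 (continuous_eps f m) (Hf m) d d0.
  pose r := Rmax 0 (m - c / 2).
  have hr : 0 <= r < m by split; [apply: Rmax_l | apply: Rmax_lub_lt; rlra].
  have hrc : m - c / 2 <= r by apply: Rmax_r.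
  have := Hc r ltac:(rewrite Rabs_left1; rlra); rewrite norm_minus_sym.
  have := norm_minus_triangle (f m) (f r) (f 0); have := below r hr.
  by have := Rmult_le_compat_l e r m ltac:(rlra) ltac:(rlra); rlra.
have mlt : m < t1 by case: mt => // me; rewrite me in at_m; rlra.
have [d [d0 Hd']] := proj1 (right_lim_eps _ _) (Hd m m0) e ep.
pose h := Rmin (d / 2) (t1 - m).
have h0 : 0 < h by apply: Rmin_pos; rlra.
have hd : h <= d / 2 by apply: Rmin_l.
have ht : h <= t1 - m by apply: Rmin_r.
have : m + h <= m; last rlra.
apply: Hub; split; first rlra.
move=> r hr; case: (Rle_lt_dec m r) => hmr; last by apply: below; rlra.
case: (Req_dec m r) => [<-//|mr].
have h1 := Hd' (r - m) ltac:(rlra).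
have h2 : norm (minus (f r) (f m)) <= e * (r - m).
  have e1 : minus (f r) (f m) = rs (r - m) (minus (rs (/ (r - m)) (minus (f (m + (r - m))) (f m))) zero).
    by have -> : m + (r - m) = r by [ring]; vec Z; field; rlra.
  by rewrite e1 norm_rs Rabs_pos_eq; [rewrite Rmult_comm; apply: Rmult_le_compat_r; [rlra | exact: Rlt_le h1] | rlra].
by have := norm_minus_triangle (f r) (f m) (f 0); rlra.
Qed.

End Derivative.

Lemma derives_linear {k : scalars} {UC VC : CompleteNormedModule (field_of k)}
    (L : UC -> VC) (f : R -> UC) t (y : UC) :
  is_linear L -> derives f t y -> derives (fun s => L (f s)) t (L y).
Proof.
move=> HL H; apply: derives_eps => e e0; have [a [a0 Ha]] := linear_norm _ HL.
have ea : 0 < e / a by apply: Rdiv_lt_0_compat.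
have [d [d0 Hd]] := derives_bound f t y _ H ea; exists d; split=> // h hh.
rewrite -(linear_rs L) // -!(linear_minus L) //; apply: Rle_trans (Ha _) _.
have -> : e * Rabs h = a * (e / a * Rabs h) by field; rlra.
by apply: Rmult_le_compat_l; [rlra | apply: Hd].
Qed.

(** * Extending a semigroup to a group by an involution that reverses its generator *)

Section ReversibleGroup.
Context {k : scalars}.
Local Notation K := (field_of k).
Context {ZC : CompleteNormedModule K}.
Local Notation Z := (CompleteNormedModule.NormedModule K ZC).
Variables (S : R -> Z -> Z) (M w : R) (J : Z -> Z).
Hypotheses (HS : semigroup S M w) (HJ : is_linear J) (JJ : forall x, J (J x) = x)
  (Jgen : forall x y, gen S x y -> gen S (J x) (opp (J y))).
Implicit Types (x y z : Z) (s t h : R).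

Lemma lim_orbit (u : R -> Z) y : filterlim u (at_right 0) (locally y) ->
  filterlim (fun h => S h (u h)) (at_right 0) (locally y).
Proof.
move=> Hu; apply/right_lim_eps => e e0.
have M1 := sg_M _ _ _ HS; have E := exp_pos (w * 1).
have B0 : 0 < M * exp (w * 1) by apply: Rmult_lt_0_compat; rlra.
have eB : 0 < e / 2 / (M * exp (w * 1)) by apply: Rdiv_lt_0_compat; rlra.
have [d1 [d10 H1]] := proj1 (right_lim_eps _ _) Hu _ eB.
have [d2 [d20 H2]] := proj1 (continuous_eps _ 0) (sg_cts _ _ _ HS y 0) (e / 2) ltac:(rlra).
exists (Rmin 1 (Rmin d1 d2)); split; first by apply: Rmin_pos; [rlra | apply: Rmin_pos].
move=> h [h0 hh].
have hh0 := Rlt_le_trans _ _ _ hh (Rmin_l _ _).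
have hh1 := Rlt_le_trans _ _ _ hh (Rle_trans _ _ _ (Rmin_r _ _) (Rmin_l _ _)).
have hh2 := Rlt_le_trans _ _ _ hh (Rle_trans _ _ _ (Rmin_r _ _) (Rmin_r _ _)).
apply: Rle_lt_trans (norm_minus_triangle _ (S h y) _) _.
have := H2 h ltac:(rewrite Rabs_pos_eq; rlra); rewrite (sg_zero _ _ _ HS).
have : norm (minus (S h (u h)) (S h y)) <= e / 2; last rlra.
rewrite -(sg_minus _ _ _ HS); apply: Rle_trans (sg_bound_le _ _ _ HS h 1 _ ltac:(rlra) ltac:(rlra)) _.
have -> : e / 2 = M * exp (w * 1) * (e / 2 / (M * exp (w * 1))) by field; split; apply: Rgt_not_eq; rlra.
by apply: Rmult_le_compat_l; [rlra | apply: Rlt_le; apply: H1].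
Qed.

(** For [z] in the domain the two terms of the product rule for [S s (J (S s (J z)))] cancel,
    because [Jgen] changes the sign of the generator. A vanishing right derivative suffices for
    constancy, and density of the domain reaches every [x]. *)
Lemma reversal_right t x : 0 <= t -> S t (J (S t (J x))) = x.
Proof.
move=> t0.
have Hlin : is_linear (fun x => S t (J (S t (J x)))).
  have SL := sg_linear _ _ _ HS t.
  exact: (is_linear_comp _ _ (is_linear_comp _ _ (is_linear_comp _ _ HJ SL) HJ) SL).
have on_domain z y : gen S z y -> S t (J (S t (J z))) = z.
  move=> Hz; pose f s := S s (J (S s (J z))).
  have f0 : f 0 = z by rewrite /f !(sg_zero _ _ _ HS) JJ.
  rewrite -[RHS]f0; apply: (right_derivative_zero f) => // [|s s0].
    apply: (cts_sg _ _ _ HS (fun s => J (S s (J z)))).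
    by apply: cts_linear => //; apply: sg_cts HS _.
  pose u := S s (J z).
  have Hu : gen S u (S s (opp (J y))) := gen_orbit _ _ _ HS s _ _ s0 (Jgen _ _ Hz).
  have HJu := Jgen _ _ Hu; set a := S s (opp (J y)) in Hu HJu.
  have L1 := lim_orbit _ _ (lim_linear _ _ _ HJ Hu).
  have L2 := lim_linear _ _ _ (sg_linear _ _ _ HS s) (right_lim_plus _ _ _ _ L1 HJu).
  have e0 : S s (plus (J a) (opp (J a))) = zero.
    by rewrite plus_opp_r; apply: linear_zero (sg_linear _ _ _ HS s).
  rewrite e0 in L2; apply: (right_lim_ext _ _ _ _ L2) => h hh.
  rewrite /f (sg_add _ _ _ HS h s) //; last rlra.
  have -> : S (s + h) (J z) = S h u by rewrite Rplus_comm (sg_add _ _ _ HS) //; rlra.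
  rewrite -(sg_minus _ _ _ HS) -(sg_rs _ _ _ HS); congr (S s _).
  rewrite (linear_rs J) // (linear_minus J) // (sg_rs _ _ _ HS) (sg_minus _ _ _ HS).
  by rewrite -/u; vec Z.
apply: eq_of_norm_le => e e0; have [m [m0 Hm]] := linear_norm _ Hlin.
have em : 0 < e / (m + 1) by apply: Rdiv_lt_0_compat; rlra.
have [y [z [Hy Ny]]] := gen_dense _ _ _ HS x _ em.
apply: Rle_trans (norm_minus_triangle _ y _) _.
have : norm (minus (S t (J (S t (J x)))) y) <= m * norm (minus y x).
  by rewrite (norm_minus_sym y) -{1}(on_domain _ _ Hy) -(linear_minus _ _ _ Hlin).
have -> : e = (m + 1) * (e / (m + 1)) by field; rlra.
have := Rmult_le_compat_l (m + 1) _ _ ltac:(rlra) (Rlt_le _ _ Ny); rlra.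
Qed.

Lemma reversal_left t x : 0 <= t -> J (S t (J (S t x))) = x.
Proof. by move=> t0; rewrite -{1}(JJ x) reversal_right // JJ. Qed.

(** One formula covers both signs of [t]: as [S] is frozen at negative times, one of the two factors
    is always the identity. *)
Definition group t x : Z := S t (J (S (- t) (J x))).

Lemma sg_neg t x : t <= 0 -> S t x = x.
Proof. by move=> t0; rewrite (sg_max _ _ _ HS) Rmax_left // (sg_zero _ _ _ HS). Qed.

Lemma group_pos t x : 0 <= t -> group t x = S t x.
Proof. by move=> t0; rewrite /group (sg_neg (- t)) ?JJ //; rlra. Qed.

Lemma group_neg t x : t <= 0 -> group t x = J (S (- t) (J x)).
Proof. by move=> t0; rewrite /group (sg_neg t). Qed.

Lemma group_zero x : group 0 x = x.
Proof. by rewrite group_pos ?(sg_zero _ _ _ HS) //; rlra. Qed.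

Lemma group_opp t x : group (- t) x = J (group t (J x)).
Proof.
case: (Rle_lt_dec 0 t) => t0.
  by rewrite group_neg ?(group_pos t) ?Ropp_involutive //; rlra.
by rewrite group_pos ?(group_neg t) ?JJ //; rlra.
Qed.

Lemma group_linear t : is_linear (group t).
Proof.
exact: (is_linear_comp _ _ (is_linear_comp _ _ (is_linear_comp _ _ HJ
  (sg_linear _ _ _ HS (- t))) HJ) (sg_linear _ _ _ HS t)).
Qed.

(** For times of opposite sign the longer one is split into a sum, and the reversal identities
    cancel the equal parts. *)
Lemma group_add t s x : group (t + s) x = group t (group s x).
Proof.
have A := sg_add _ _ _ HS.
case: (Rle_lt_dec 0 t) => t0; case: (Rle_lt_dec 0 s) => s0.
- by rewrite !group_pos ?A //; rlra.
- rewrite (group_pos t) // (group_neg s); last rlra.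
  case: (Rle_lt_dec 0 (t + s)) => ts.
    rewrite group_pos // -{1}(reversal_right (- s) x) -?A; try rlra.
    by congr (S _ _); ring.
  rewrite group_neg; last rlra.
  have -> : - s = t + - (t + s) by ring.
  by rewrite A; try rlra; rewrite -{2}(JJ (S (- (t + s)) (J x))) reversal_right.
- rewrite (group_neg t) ?(group_pos s) //; last rlra.
  case: (Rle_lt_dec 0 (t + s)) => ts.
    rewrite group_pos //; have e : s = - t + (t + s) by ring.
    by rewrite [in RHS]e (A (t + s) (- t)); try rlra; rewrite reversal_left //; rlra.
  rewrite group_neg; last rlra.
  have e : - t = - (t + s) + s by ring.
  by rewrite e (A s (- (t + s))); try rlra; rewrite -[in LHS](reversal_left s x) // JJ.
- rewrite !group_neg; try rlra; rewrite JJ -A; try rlra.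
  by congr (J (S _ _)); ring.
Qed.

Lemma cts_group x : cts (fun t => group t x).
Proof.
apply: (cts_sg _ _ _ HS (fun t => J (S (- t) (J x)))); apply: cts_linear => //.
apply: (cts_comp (fun t => S t (J x)) Ropp); first exact: sg_cts HS _.
by move=> t; apply: (continuous_opp (V := R_NormedModule)); apply: continuous_id.
Qed.

Lemma gen_group t x y : gen S x y -> gen S (group t x) (group t y).
Proof.
move=> H; case: (Rle_lt_dec 0 t) => t0.
  by rewrite !group_pos //; apply: gen_orbit HS _ _ _ t0 H.
rewrite !group_neg; try rlra.
have := Jgen _ _ (gen_orbit _ _ _ HS (- t) _ _ ltac:(rlra) (Jgen _ _ H)).
by rewrite (linear_opp _ _ (sg_linear _ _ _ HS (- t))) (linear_opp J) // opp_opp.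
Qed.

Lemma gen_eps x y e : gen S x y -> 0 < e -> exists d, 0 < d /\
  forall h, 0 <= h < d -> norm (minus (minus (S h x) x) (rs h y)) <= e * h.
Proof.
move=> H e0; have [d [d0 Hd]] := proj1 (right_lim_eps _ _) H e e0.
exists d; split=> // h hh; case: (Req_dec h 0) => [->|hn].
  rewrite (sg_zero _ _ _ HS); have -> : minus (minus x x) (rs 0 y) = zero by vec Z.
  by rewrite norm_zero; rlra.
have -> : minus (minus (S h x) x) (rs h y) = rs h (minus (rs (/ h) (minus (S h x) x)) y).
  by vec Z; field; rlra.
rewrite norm_rs Rabs_pos_eq; last rlra.
have := Hd h ltac:(rlra) => h1; rewrite Rmult_comm; apply: Rmult_le_compat_r; rlra.
Qed.

(** The generator controls only right difference quotients. Left ones are right quotients of the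
    reflected orbit, and the group law carries the estimate from time 0 to time [t]. *)
Lemma group_derives x y t : gen S x y -> derives (fun s => group s x) t (group t y).
Proof.
move=> H; apply: derives_eps => e e0.
have [a [a0 Ha]] := linear_norm _ (group_linear t).
have [b [b0 Hb]] := linear_norm _ HJ.
have ea : 0 < e / a by apply: Rdiv_lt_0_compat.
have eab : 0 < e / a / b by apply: Rdiv_lt_0_compat.
have [d1 [d10 H1]] := gen_eps _ _ _ H ea.
have [d2 [d20 H2]] := gen_eps _ _ _ (Jgen _ _ H) eab.
exists (Rmin d1 d2); split; first exact: Rmin_pos.
move=> h hh.
have hh1 := Rlt_le_trans _ _ _ hh (Rmin_l _ _).
have hh2 := Rlt_le_trans _ _ _ hh (Rmin_r _ _).
rewrite group_add -(linear_rs (group t)) -?(linear_minus (group t));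
  try exact: group_linear.
have -> : e * Rabs h = a * (e / a * Rabs h) by field; rlra.
apply: Rle_trans (Ha _) _; apply: Rmult_le_compat_l; first rlra.
case: (Rle_lt_dec 0 h) => h0.
  by rewrite group_pos // Rabs_pos_eq //; apply: H1; rewrite Rabs_pos_eq in hh1; rlra.
rewrite group_neg; last rlra.
rewrite Rabs_left in hh2 * => //.
have -> : minus (minus (J (S (- h) (J x))) x) (rs h y) =
    J (minus (minus (S (- h) (J x)) (J x)) (rs (- h) (opp (J y)))).
  rewrite !(linear_minus J) // (linear_rs J) // (linear_opp J) // !JJ; vec Z.
apply: Rle_trans (Hb _) _.
have -> : e / a * - h = b * (e / a / b * - h) by field; rlra.
by apply: Rmult_le_compat_l; [rlra | apply: H2; rlra].
Qed.

End ReversibleGroup.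

(** * From the phase space to the cosine function *)

Section Product.
Context {k : scalars}.
Local Notation K := (field_of k).

Definition prod_CompleteSpace_mixin (F E : CompleteNormedModule K) :
  CompleteSpace.mixin_of (prod_NormedModule K F E).
Proof.
refine (@CompleteSpace.Mixin (prod_NormedModule K F E)
  (fun H => (lim (fun P : F -> Prop => H (fun p => P p.1)),
             lim (fun P : E -> Prop => H (fun p => P p.2)))) _ _).
- move=> H PH cH e.
  have P1 : ProperFilter (fun P : F -> Prop => H (fun p => P p.1)).
    exact: (@filtermap_proper_filter (F * E) F fst H PH).
  have P2 : ProperFilter (fun P : E -> Prop => H (fun p => P p.2)).
    exact: (@filtermap_proper_filter (F * E) E snd H PH).
  apply: filter_and.
    apply: (complete_cauchy _ P1) => e'; have [x Hx] := cH e'; exists x.1.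
    by apply: filter_imp Hx => p [].
  apply: (complete_cauchy _ P2) => e'; have [x Hx] := cH e'; exists x.2.
  by apply: filter_imp Hx => p [].
- move=> H1 H2 H12 H21 e; split; apply: close_lim => P; try exact: H12; exact: H21.
Defined.

Definition prod_complete (F E : CompleteNormedModule K) : CompleteNormedModule K :=
  CompleteNormedModule.Pack K (F * E)
    (CompleteNormedModule.Class K (F * E) (NormedModule.class K (prod_NormedModule K F E))
      (prod_CompleteSpace_mixin F E)) (F * E).

(** The product norm is Euclidean, and [norm_prod] compares it with the maximum up to [sqrt 2], here
    rounded up to 2. *)
Lemma norm_inl {F E : NormedModule K} (v : F) : norm (v, (zero : E)) <= 2 * norm v.
Proof.
have [_ h] := norm_prod v (zero : E); rewrite norm_zero in h.
rewrite Rmax_left in h; last exact: norm_ge_0.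
apply: Rle_trans h _; apply: Rmult_le_compat_r; first exact: norm_ge_0.
by rewrite -{2}(sqrt_square 2); [apply: sqrt_le_1; rlra | rlra].
Qed.

Lemma norm_inr {F E : NormedModule K} (x : E) : norm ((zero : F), x) <= 2 * norm x.
Proof.
have [_ h] := norm_prod (zero : F) x; rewrite norm_zero in h.
rewrite Rmax_right in h; last exact: norm_ge_0.
apply: Rle_trans h _; apply: Rmult_le_compat_r; first exact: norm_ge_0.
by rewrite -{2}(sqrt_square 2); [apply: sqrt_le_1; rlra | rlra].
Qed.

Lemma is_linear_inr {F E : NormedModule K} :
  @is_linear K E (prod_NormedModule K F E) (fun x => (zero, x)).
Proof. exact: (is_linear_prod _ _ is_linear_zero is_linear_id). Qed.

End Product.

(** * The cosine function read off the phase group, and its generator *)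

Section Phase.
Context {k : scalars}.
Local Notation K := (field_of k).
Context {FC EC : CompleteNormedModule K}.
Local Notation F := (CompleteNormedModule.NormedModule K FC).
Local Notation E := (CompleteNormedModule.NormedModule K EC).
Local Notation Z := (prod_complete FC EC).
Local Notation ZN := (CompleteNormedModule.NormedModule K (prod_complete FC EC)).
Variables (T : operator E) (j : F -> E).
Hypotheses (Hj : is_linear j) (Tj : forall x, dom T x -> exists v, j v = x).
Variables (S : R -> ZN -> ZN) (M w : R).
Hypotheses (HS : semigroup (ZC := Z) S M w)
  (SG : forall p q : ZN, phase_graph T j p q <-> gen (ZC := Z) S p q).

Let emb (x : E) : ZN := (zero, x).
Let refl (p : ZN) : ZN := (p.1, opp p.2).

Lemma refl_linear : is_linear refl.
Proof.
exact: (is_linear_prod _ _ is_linear_fst (is_linear_comp _ _ is_linear_snd is_linear_opp)).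
Qed.

Lemma reflK p : refl (refl p) = p.
Proof. by rewrite /refl /= opp_opp; case: p. Qed.

Lemma gen_refl (p q : ZN) : gen (ZC := Z) S p q -> gen (ZC := Z) S (refl p) (opp (refl q)).
Proof.
move=> /SG [e1 e2]; apply/SG; split => /=.
  by rewrite (linear_opp j) // e1.
by change (graph T (j p.1) (opp (opp q.2))); rewrite opp_opp.
Qed.

Let G : R -> ZN -> ZN := group (ZC := Z) S refl.

Lemma GL t : is_linear (G t).
Proof. exact: (group_linear _ _ _ _ HS refl_linear). Qed.

Lemma phase_dom v : dom T (j v) -> phase_graph T j (v, zero) (zero, T (j v)).
Proof. by move=> Hv; split; [exact: linear_zero | split]. Qed.

(** Linearity is not part of [operator], so that [T] is defined and vanishes at zero is deduced: the
    generator has some pair in its graph, and scaling it by 0 gives the zero pair. *)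
Lemma phase_emb v : phase_graph T j (zero, j v) (v, zero).
Proof.
have H0 : phase_graph T j zero zero.
  apply/SG; have [p [q [H _]]] := gen_dense _ _ _ HS zero 1 ltac:(rlra).
  have := gen_rs _ 0 _ _ (sg_linear _ _ _ HS) H.
  by rewrite !(rs_zero_l (Z := ZN)).
by split; case: H0.
Qed.

Definition cosine t (x : E) : E := (G t (emb x)).2.

Lemma cosine_linear t : is_linear (cosine t).
Proof. exact: (is_linear_comp _ _ (is_linear_comp _ _ is_linear_inr (GL t)) is_linear_snd). Qed.

(** By reflection, [G (- s) (0, x)] and [G s (0, x)] have opposite first components and equal second
    ones. Their sum is [(0, 2 C(s) x)], and applying [G t] gives the cosine equation. *)
Lemma cosine_COF : @is_COF k EC cosine.
Proof.
split; first exact: cosine_linear.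
have Gc p := cts_group _ _ _ _ HS refl_linear p.
split; first by move=> x t; apply: (continuous_linear (U := ZN) (V := E) snd _ _ is_linear_snd); apply: Gc.
split; first by move=> x; rewrite /cosine /G (group_zero _ _ _ _ HS reflK).
move=> t s x; rewrite /cosine.
have Gadd a b p : G (a + b) p = G a (G b p).
  exact: (group_add _ _ _ _ HS refl_linear reflK gen_refl).
have er : refl (emb x) = opp (emb x).
  by rewrite /refl /emb /=; congr pair; rewrite -[LHS]opp_zero.
have e1 : G (- s) (emb x) = opp (refl (G s (emb x))).
  rewrite /G (group_opp _ _ _ _ HS reflK) -/G er (linear_opp _ _ (GL s)).
  by rewrite (linear_opp _ _ refl_linear).
have e2 : plus (G s (emb x)) (G (- s) (emb x)) = rs 2 (emb (cosine s x)).
  rewrite e1 /refl /emb /cosine; case: (G s (emb x)) => a b.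
  change ((plus a (opp a), plus b (opp (opp b))) = (rs 2 (zero : F), rs 2 b)).
  by congr pair; [vec F | vec E].
have : plus (G (t + s) (emb x)) (G (t - s) (emb x)) = rs 2 (G t (emb (cosine s x))).
  by rewrite /Rminus !Gadd -(linear_plus _ (GL t)) e2 (linear_rs _ _ _ (GL t)).
by move=> /(f_equal snd).
Qed.

(** The group preserves the graph of the generator; this is the first phase equation for the
    transported pair [(0, j v)], [(v, 0)]. *)
Lemma orbit_cosine v t : j (G t (v, zero)).1 = cosine t (j v).
Proof.
have := gen_group _ _ _ _ HS refl_linear reflK gen_refl t _ _ (proj1 (SG _ _) (phase_emb v)).
by move=> /SG [].
Qed.

Lemma cosine_dom t x : dom T x -> dom T (cosine t x) /\ T (cosine t x) = cosine t (T x).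
Proof.
move=> Hx; have [v jv] := Tj _ Hx; rewrite -jv in Hx *.
have := gen_group _ _ _ _ HS refl_linear reflK gen_refl t _ _ (proj1 (SG _ _) (phase_dom v Hx)).
by move=> /SG [_]; rewrite orbit_cosine.
Qed.

(** The intermediate function is the sine function applied to [T x]. With [j v = x], the orbit of
    [(v, 0)] has the orbit of [(0, T x)] as derivative; the two claims are its two components, the
    first one sent to [E] by [j]. *)
Lemma cosine_derives t x : dom T x ->
  derives (ZC := EC) (fun s => cosine s x) t (j (G t (emb (T x))).1) /\
  derives (ZC := EC) (fun s => j (G s (emb (T x))).1) t (cosine t (T x)).
Proof.
move=> Hx; have [v jv] := Tj _ Hx; rewrite -jv in Hx *.
have Hd s := group_derives _ _ _ _ HS refl_linear reflK gen_refl _ _ s (proj1 (SG _ _) (phase_dom v Hx)).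
have H2 s := derives_linear (UC := Z) (VC := EC) snd _ _ _ is_linear_snd (Hd s).
have Hj1 : @is_linear K ZN E (fun p => j p.1) := is_linear_comp _ _ is_linear_fst Hj.
have H1 s := derives_linear (UC := Z) (VC := EC) (fun p => j p.1) _ _ _ Hj1 (Hd s).
have e s : j (G s (emb (T (j v)))).1 = (G s (v, zero)).2.
  have := gen_group _ _ _ _ HS refl_linear reflK gen_refl s _ _ (proj1 (SG _ _) (phase_dom v Hx)).
  by move=> /SG [].
split.
  by apply: derives_ext (H1 t) => s; apply: orbit_cosine.
by apply: derives_ext (H2 t) => s; apply: esym; apply: e.
Qed.

Lemma cosine_C2 x : dom T x -> C2_with_second_derivative_at_0 (fun t => cosine t x) (T x).
Proof.
move=> Hx; exists (fun t => j (G t (emb (T x))).1), (fun t => cosine t (T x)).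
split; first by move=> t; case: (cosine_derives t x Hx).
split; first by move=> t; case: (cosine_derives t x Hx).
have [_ [Hc [H0 _]]] := cosine_COF.
by split; [move=> t; apply: Hc | apply: H0].
Qed.

(* The resolvent of the phase generator, read off its off-diagonal entry. *)
Lemma second_order_resolvent : exists (l c : R) (Q : E -> F), is_linear Q /\
  (forall g, norm (Q g) <= c * norm g) /\
  (forall g, graph T (j (Q g)) (minus (rs (l * l) (j (Q g))) g)) /\
  (forall v, dom T (j v) -> Q (minus (rs (l * l) (j v)) (T (j v))) = v).
Proof.
have [Q [HQ [QD [Qinv Qb]]]] := resolvent _ _ _ (w + 2 * M) HS ltac:(rlra).
have M1 := sg_M _ _ _ HS; set l := w + 2 * M in QD Qinv Qb.
exists l, (2 * M / (l - w) * 2), (fun g => (Q (emb g)).1); split; last split; last split.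
- exact: (is_linear_comp _ _ (is_linear_comp _ _ is_linear_inr HQ) is_linear_fst).
- move=> g; apply: Rle_trans (norm_le_prod_norm_1 _) _.
  apply: Rle_trans (Qb _) _; rewrite Rmult_assoc; apply: Rmult_le_compat_l.
    by apply: Rdiv_le_0_compat; rewrite /l; rlra.
  exact: norm_inr.
- move=> g; have /SG := QD (emb g); case: (Q (emb g)) => a b [/= e1 [e2 e3]].
  split=> //; rewrite e3.
  change (minus (rs l b) g = minus (rs (l * l) (j a)) g); congr minus.
  rewrite -e1; change (rs l (j (minus (rs l a) zero)) = rs (l * l) (j a)).
  by rewrite (linear_minus j) // (linear_rs j) // (linear_zero j) //; vec E.
- move=> v Hv.
  (* The second component [rs l (j v)] is chosen so that [l] minus the generator sends this vector
     into the range of [emb]. *)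
  have H : phase_graph T j (v, rs l (j v)) (rs l v, T (j v)).
    by split; [exact: linear_rs | split].
  have := Qinv _ _ (proj1 (SG _ _) H).
  have -> : minus (rs l ((v, rs l (j v)) : ZN)) (rs l v, T (j v)) =
      emb (minus (rs (l * l) (j v)) (T (j v))).
    change ((minus (rs l v) (rs l v), minus (rs l (rs l (j v))) (T (j v))) =
      emb (minus (rs (l * l) (j v)) (T (j v)))).
    by rewrite /emb; congr pair; [vec F | vec E].
  by move=> ->.
Qed.

(* The resolvent R commutes with the cosine function, so differentiating
   R C(t) x = C(t) R x twice at 0 gives R y = l^2 R x - x. *)
Lemma C2_cosine_dom x y : C2_with_second_derivative_at_0 (fun t => cosine t x) y -> graph T x y.
Proof.
move=> [f' [f'' [Hf [Hf' [_ <-]]]]].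
have [l [c [Q [HQ [_ [QD Qinv]]]]]] := second_order_resolvent.
pose P g := j (Q g); have HP : is_linear P := is_linear_comp _ _ HQ Hj.
(* [C(t) P g] stays in the domain and [T] commutes with [C(t)] there, so applying [l^2 - T] to it
   gives [C(t) g]; the left inverse property of [Q] concludes. *)
have comm t g : P (cosine t g) = cosine t (P g).
  have [Hd HT] := QD g; have [Hd' HT'] := cosine_dom t _ Hd.
  have [v jv] := Tj _ Hd'.
  have -> : cosine t g = minus (rs (l * l) (j v)) (T (j v)).
    rewrite jv HT' HT (linear_minus _ _ _ (cosine_linear t)) (linear_rs _ _ _ (cosine_linear t)).
    by vec E.
  by rewrite /P Qinv jv.
have D1 t := cosine_derives t _ (proj1 (QD x)).
have e1 t : P (f' t) = j (G t (emb (T (P x)))).1.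
  apply: (derives_unique (ZC := EC) (fun s => cosine s (P x)) t); last by case: (D1 t).
  apply: (derives_ext (ZC := EC) (fun s => P (cosine s x))) => //.
  exact: (derives_linear (UC := EC) (VC := EC) P _ t _ HP (Hf t)).
have e2 : P (f'' 0) = T (P x).
  have [_ [_ [H0 _]]] := cosine_COF; rewrite -[RHS]H0.
  apply: (derives_unique (ZC := EC) (fun s => j (G s (emb (T (P x)))).1) 0); last by case: (D1 0).
  apply: (derives_ext (ZC := EC) (fun s => P (f' s))) => //.
  exact: (derives_linear (UC := EC) (VC := EC) P _ 0 _ HP (Hf' 0)).
have [_ e3] := QD x; rewrite -/(P x) -e2 in e3.
(* This exhibits [x] in the range of the resolvent, hence in the domain. *)
have ex : P (minus (rs (l * l) x) (f'' 0)) = x.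
  by rewrite (linear_minus P) // (linear_rs P) // e3; vec E.
have [d0 Tx] := QD (minus (rs (l * l) x) (f'' 0)); rewrite -/(P _) ex in d0 Tx.
by split=> //; rewrite Tx; vec E.
Qed.

End Phase.

(** Only inclusion of the domain in the range of [j] is assumed. Its boundedness comes from the
    resolvent: the preimage of [x] is [Q (l^2 x - T x)], and [Q] is bounded into [F]. *)
Lemma phase_generation {k : scalars} {F E : CompleteNormedModule (field_of k)}
    (T : operator E) (j : F -> E) :
  continuous_embedding j -> (forall x, dom T x -> exists v, j v = x) ->
  generated (ZC := prod_complete F E) (phase_graph T j) ->
  generates_COF_with_phase_space T j.
Proof.
move=> [Hj jinj] Tj HG; split; last split=> //; last split.
- have [S [M [w [HS SG]]]] := HG.
  exists (cosine (FC := F) (EC := E) S); split; first exact: cosine_COF Hj _ _ _ HS SG.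
  move=> x y; split; last exact: C2_cosine_dom Hj Tj _ _ _ HS SG _ _.
  by move=> [Hx <-]; apply: cosine_C2 Hj Tj _ _ _ HS SG _ Hx.
- have [S [M [w [HS SG]]]] := HG.
  have [l [c [Q [HQ [Qb [QD Qinv]]]]]] := second_order_resolvent _ _ Hj _ _ _ HS SG.
  split=> //; split=> //.
  exists (Rabs c * (Rabs (l * l) + 1)) => x Hx; have [v jv] := Tj _ Hx; exists v; split=> //.
  rewrite -{1}(Qinv v) jv //; apply: Rle_trans (Qb _) _.
  have n0 := norm_ge_0 (minus (rs (l * l) x) (T x)).
  apply: Rle_trans (Rmult_le_compat_r _ _ _ n0 (Rle_abs c)) _.
  rewrite Rmult_assoc; apply: Rmult_le_compat_l; first exact: Rabs_pos.
  apply: Rle_trans (norm_minus_le (Z := E) _ _) _; rewrite norm_rs.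
  have := norm_ge_0 x; have := norm_ge_0 (T x); have := Rabs_pos (l * l); rnra.
- exact: (generated_C0 (ZC := prod_complete F E)) HG.
Qed.

(** * Finite products *)

(** Needed because the factors of a product, and the semigroups on them, have types that vary with
    the index. *)
Lemma dependent_choice {I : Type} {Y : I -> Type} (P : forall i, Y i -> Prop) :
  (forall i, exists y, P i y) -> exists f : forall i, Y i, forall i, P i (f i).
Proof.
move=> H; exists (fun i => proj1_sig (constructive_indefinite_description _ (H i))) => i.
exact: proj2_sig (constructive_indefinite_description _ (H i)).
Qed.

Section FiniteProducts.
Context {k : scalars}.
Local Notation K := (field_of k).
Context {n : nat}.
Implicit Types X : 'I_n -> CompleteNormedModule K.
Local Notation prodN X := (CompleteNormedModule.NormedModule K (fprod_CompleteNormedModule X)).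

Lemma norm_fprod_le X (x : prodN X) c : 0 <= c -> (forall i, norm (x i) <= c) -> norm x <= c.
Proof. exact: bigRmax_le. Qed.

Lemma norm_fprod_ge X (x : prodN X) i : norm (x i) <= norm x.
Proof. exact: (le_bigRmax (fun i => norm (x i)) i). Qed.

Lemma is_linear_proj X i : @is_linear K (prodN X) (X i) (fun x => x i).
Proof.
split=> //; exists 1; split; first rlra.
by move=> x; rewrite Rmult_1_l; apply: norm_fprod_ge.
Qed.

Lemma is_linear_fprod {U : NormedModule K} X (L : U -> prodN X) :
  (forall i, @is_linear K U (X i) (fun u => L u i)) -> is_linear L.
Proof.
move=> H; split.
- by move=> x y; apply: functional_extensionality_dep => i; apply: linear_plus (H i) x y.
- by move=> a x; apply: functional_extensionality_dep => i; apply: linear_scal (H i) a x.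
have [m Hm] := dependent_choice _ (fun i => linear_norm _ (H i)).
exists (1 + \big[Rmax/0]_(i < n) m i).
have m0 : 0 <= \big[Rmax/0]_(i < n) m i.
  by apply: bigRmax_ge0 => i; apply: Rlt_le; case: (Hm i).
split; first rlra.
move=> x; have nx := norm_ge_0 x; apply: norm_fprod_le => [|i]; first by apply: Rmult_le_pos; rlra.
apply: Rle_trans (proj2 (Hm i) x) _; apply: Rmult_le_compat_r => //.
by have := le_bigRmax m i; rlra.
Qed.

Lemma lim_fprod {T : Type} {F : (T -> Prop) -> Prop} {FF : Filter F} X (f : T -> prodN X) (l : prodN X) :
  (forall i, filterlim (fun t => f t i) F (locally (l i))) -> filterlim f F (locally l).
Proof.
move=> H; apply/filterlim_locally => e.
apply: (@filter_forall_ord K n X (fun P => F (fun t => P (f t)))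
  (fun i x => ball (l i) e (x i))) => i.
by have /filterlim_locally := H i; apply.
Qed.

Lemma lim_pair {T : Type} {F : (T -> Prop) -> Prop} {FF : Filter F} {U V : NormedModule K}
    (f : T -> prod_NormedModule K U V) (l : prod_NormedModule K U V) :
  filterlim (fun t => (f t).1) F (locally l.1) -> filterlim (fun t => (f t).2) F (locally l.2) ->
  filterlim f F (locally l).
Proof.
move=> H1 H2; apply/filterlim_locally => e.
have /filterlim_locally /(_ e) h1 := H1; have /filterlim_locally /(_ e) h2 := H2.
exact: filter_and h1 h2.
Qed.

Section ProductSemigroup.
Variables (V X : 'I_n -> CompleteNormedModule K) (j : forall i, V i -> X i)
  (A : forall i, operator (X i)).
Local Notation Z := (prod_NormedModule K (prodN V) (prodN X)).
Local Notation Zi i := (prod_NormedModule K (V i) (X i)).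

Definition diagonal : operator (fprod X) :=
  Operator (fun u => forall i, dom (A i) (u i)) (fun u i => A i (u i)).

Let comp i (p : Z) : Zi i := (p.1 i, p.2 i).

Lemma is_linear_comp_i i : is_linear (comp i).
Proof.
apply: (is_linear_prod (T := Z) (U := V i) (V := X i)).
  exact: (is_linear_comp (U := Z) (V := prodN V) (W := V i) fst _ is_linear_fst (is_linear_proj V i)).
exact: (is_linear_comp (U := Z) (V := prodN X) (W := X i) snd _ is_linear_snd (is_linear_proj X i)).
Qed.

Lemma lim_comp {T : Type} {F : (T -> Prop) -> Prop} {FF : Filter F} (f : T -> Z) (l : Z) :
  (forall i, filterlim (fun t => comp i (f t)) F (locally (comp i l))) <->
  filterlim f F (locally l).
Proof.
split=> [H|H i]; last exact: lim_linear (is_linear_comp_i i) H.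
apply: lim_pair; apply: lim_fprod => i.
  exact: (lim_linear (U := Zi i) (V := V i) fst _ _ is_linear_fst (H i)).
exact: (lim_linear (U := Zi i) (V := X i) snd _ _ is_linear_snd (H i)).
Qed.

(** Limits in a finite product are componentwise, filters being closed under finite intersections.
    So difference quotients converge exactly when those of all components do, and the domain is the
    full product. *)
Lemma diagonal_generates :
  (forall i, @generates_C0_semigroup k (Zi i) (phase_graph (A i) (@j i))) ->
  @generates_C0_semigroup k Z (phase_graph diagonal (fprod_map j)).
Proof.
move=> H; have [S HS] := dependent_choice _ H.
pose W t (p : Z) : Z := ((fun i => (S i t (comp i p)).1), (fun i => (S i t (comp i p)).2)).
have WE t p i : comp i (W t p) = S i t (comp i p) by rewrite /comp /W /=; case: (S i t _).
have ext (p q : Z) : (forall i, comp i p = comp i q) -> p = q.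
  case: p q => [p1 p2] [q1 q2] e; congr pair; apply: functional_extensionality_dep => i.
    by have := f_equal fst (e i).
  by have := f_equal snd (e i).
exists W; split; last first.
  move=> p q; split=> [Hpq|Hq].
    apply/lim_comp => i; have [_ G] := HS i.
    have Hi : phase_graph (A i) (@j i) (comp i p) (comp i q).
      case: Hpq => [e1 [d e2]]; split; first by rewrite -[RHS]/(p.2 i) -e1.
      by split; [exact: d | rewrite -[RHS]/(q.2 i) -e2].
    move/G: Hi; apply: filterlim_ext => h; rewrite -WE.
    by rewrite -(linear_minus _ _ _ (is_linear_comp_i i)) -(linear_scal _ (is_linear_comp_i i)).
  have Hi i : phase_graph (A i) (@j i) (comp i p) (comp i q).
    have [_ G] := HS i; apply/G; move/lim_comp: Hq => /(_ i); apply: filterlim_ext => h.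
    by rewrite -WE (linear_scal _ (is_linear_comp_i i)) (linear_minus _ _ _ (is_linear_comp_i i)).
  split; first by apply: functional_extensionality_dep => i; case: (Hi i).
  split=> [i|]; first by case: (Hi i) => _ [].
  by apply: functional_extensionality_dep => i; case: (Hi i) => _ [].
split.
  move=> t t0; have L i : is_linear (fun p => S i t (comp i p)).
    by have [[HL _] _] := HS i; apply: (is_linear_comp _ _ (is_linear_comp_i i) (HL t t0)).
  apply: (is_linear_prod (U := prodN V) (V := prodN X)); apply: is_linear_fprod => i.
    exact: (is_linear_comp (V := Zi i) (W := V i) _ _ (L i) is_linear_fst).
  exact: (is_linear_comp (V := Zi i) (W := X i) _ _ (L i) is_linear_snd).
split; first by move=> p; apply: ext => i; rewrite WE; case: (HS i) => [[_ [-> _]]].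
split.
  move=> s t p s0 t0; apply: ext => i; rewrite !WE.
  by have [[_ [_ [Hadd _]]] _] := HS i; apply: Hadd.
move=> p t t0; apply/lim_comp => i; rewrite WE.
have [[_ [_ [_ Hc]]] _] := HS i; have := Hc (comp i p) t t0.
by apply: filterlim_ext => s; rewrite WE.
Qed.

End ProductSemigroup.
End FiniteProducts.

(** * The coupled system *)

Section Coupling.
Context {k : scalars}.
Local Notation K := (field_of k).
Context {n : nat}.
Variables (V X : 'I_n -> CompleteNormedModule K) (j : forall i, V i -> X i)
  (A : forall i, operator (X i)).
Local Notation VC := (fprod_CompleteNormedModule V).
Local Notation XC := (fprod_CompleteNormedModule X).
Local Notation VN := (CompleteNormedModule.NormedModule K VC).
Local Notation XN := (CompleteNormedModule.NormedModule K XC).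
Hypothesis Hj : forall i, is_linear (@j i).

Let J : VN -> XN := fprod_map j.
Let D : operator XN := diagonal X A.

(** Neither kind of entry contains the other, so a sum is kept as a pair: [P1] collects what is
    bounded on the product of the [V i], [P2] what is bounded from the domain. [P1] takes [v] and
    not [J v], since only the norm of [v] controls it. The target [E] is a parameter, to cover a
    single row as well as the whole matrix. *)
Definition splits (F E : CompleteNormedModule K) (i : F -> E) (Q : XN -> E) : Prop :=
  exists (P1 : VN -> E) (P2 : XN -> E), is_linear P1 /\
    @bounded_from_domain k XC F E D i P2 /\
    forall v, dom D (J v) -> Q (J v) = plus (P1 v) (P2 (J v)).

Lemma fprod_map_linear : is_linear J.
Proof.
apply: (is_linear_fprod X) => i; exact: (is_linear_comp (U := VN) _ _ (is_linear_proj V i) (Hj i)).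
Qed.

Lemma splits_zero i : splits (V i) (X i) (@j i) (fun _ => zero).
Proof.
exists (fun _ => zero), (fun _ => zero); split; first exact: is_linear_zero.
split; last by move=> v _; rewrite plus_zero_r.
split; first by move=> x y _ _; rewrite plus_zero_r.
split; first by move=> a x _; rewrite scal_zero_r.
exists 0 => x _; exists zero; split; first exact: linear_zero (Hj i).
by rewrite norm_zero; rlra.
Qed.

Lemma splits_plus i Q Q' : splits (V i) (X i) (@j i) Q -> splits (V i) (X i) (@j i) Q' ->
  splits (V i) (X i) (@j i) (fun u => plus (Q u) (Q' u)).
Proof.
move=> [P1 [P2 [H1 [[Ha [Hs [M HM]]] HQ]]]] [P1' [P2' [H1' [[Ha' [Hs' [M' HM']]] HQ']]]].
exists (fun v => plus (P1 v) (P1' v)), (fun u => plus (P2 u) (P2' u)).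
split; first exact: is_linear_add.
split; last by move=> v Hv; rewrite HQ // HQ' //; vec (CompleteNormedModule.NormedModule K (X i)).
split; first by move=> x y Hx Hy; rewrite Ha // Ha' //; vec (CompleteNormedModule.NormedModule K (X i)).
split; first by move=> a x Hx; rewrite Hs // Hs' // scal_distr_l.
exists (M + M') => x Hx; have [v [jv nv]] := HM x Hx; have [v' [jv' nv']] := HM' x Hx.
exists (plus v v'); split; first by rewrite -jv -jv'; apply: linear_plus (Hj i) v v'.
by apply: Rle_trans (norm_triangle _ _) _; rlra.
Qed.

Lemma splits_entry i l (B : X l -> X i) :
  bounded_from_domain (A l) (@j i) B \/ is_linear (fun v : V l => B (j l v)) ->
  splits (V i) (X i) (@j i) (fun u => B (u l)).
Proof.
case=> [[Ha [Hs [M HM]]]|HB].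
  exists (fun _ => zero), (fun u => B (u l)); split; first exact: is_linear_zero.
  split; last by move=> v _; rewrite plus_zero_l.
  split; first by move=> x y Hx Hy; apply: Ha.
  split; first by move=> a x Hx; apply: Hs.
  exists (Rabs M) => x Hx; have [v [jv nv]] := HM (x l) (Hx l); exists v; split=> //.
  have h1 := norm_fprod_ge X x l; have h2 := norm_fprod_ge X (D x) l.
  have n1 := norm_ge_0 (x l); have n2 := norm_ge_0 (A l (x l)).
  apply: Rle_trans nv _; apply: Rle_trans (Rmult_le_compat_r _ _ _ _ (Rle_abs M)) _; first rlra.
  by apply: Rmult_le_compat_l; [exact: Rabs_pos | exact: Rplus_le_compat].
exists (fun v : VN => B (j l (v l))), (fun _ => zero).
split; first exact: (is_linear_comp (U := VN) (V := V l) _ _ (is_linear_proj V l) HB).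
split; last by move=> v _; rewrite plus_zero_r.
split; first by move=> x y _ _; rewrite plus_zero_r.
split; first by move=> a x _; rewrite scal_zero_r.
exists 0 => x _; exists zero; split; first exact: linear_zero (Hj i).
by rewrite norm_zero; rlra.
Qed.

Lemma splits_sum i (P : pred 'I_n) (B : forall l, X l -> X i) :
  (forall l, P l -> splits (V i) (X i) (@j i) (fun u => B l (u l))) ->
  splits (V i) (X i) (@j i) (fun u => \big[plus/zero]_(l < n | P l) B l (u l)).
Proof.
move=> H; elim: (index_enum _) => [|l s IH].
  have [P1 [P2 [H1 [H2 H3]]]] := splits_zero i; exists P1, P2; split=> //; split=> // v Hv.
  by rewrite big_nil; apply: H3.
case Pl: (P l).
  have [P1 [P2 [H1 [H2 H3]]]] := splits_plus _ _ _ (H l Pl) IH.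
  exists P1, P2; split=> //; split=> // v Hv.
  by rewrite big_cons Pl; apply: H3.
have [P1 [P2 [H1 [H2 H3]]]] := IH; exists P1, P2; split=> //; split=> // v Hv.
by rewrite big_cons Pl; apply: H3.
Qed.

Lemma splits_fprod (Q : forall i, XN -> X i) :
  (forall i, splits (V i) (X i) (@j i) (Q i)) -> splits VC XC J (fun u i => Q i u).
Proof.
move=> H; have [P1 HP1] := dependent_choice _ H; have [P2 HP2] := dependent_choice _ HP1.
exists (fun v i => P1 i v), (fun u i => P2 i u).
split; first by apply: (is_linear_fprod X) => i; case: (HP2 i).
split; last first.
  by move=> v Hv; apply: functional_extensionality_dep => i; have [_ [_ ->]] := HP2 i.
split.
  move=> x y Hx Hy; apply: functional_extensionality_dep => i.
  by have [_ [[Ha _] _]] := HP2 i; apply: Ha.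
split.
  move=> a x Hx; apply: functional_extensionality_dep => i.
  by have [_ [[_ [Hs _]] _]] := HP2 i; apply: Hs.
have HM i := proj2 (proj2 (proj1 (proj2 (HP2 i)))).
have [M {}HM] := dependent_choice _ HM.
exists (\big[Rmax/0]_(i < n) Rabs (M i)) => x Hx.
have [v Hv] := dependent_choice _ (fun i => HM i x Hx).
exists v; split; first by apply: functional_extensionality_dep => i; case: (Hv i).
have n0 : 0 <= norm x + norm (D x) by apply: Rplus_le_le_0_compat; apply: norm_ge_0.
apply: (norm_fprod_le V v) => [|i].
  by apply: Rmult_le_pos => //; apply: bigRmax_ge0 => i; apply: Rabs_pos.
apply: Rle_trans (proj2 (Hv i)) _; apply: Rmult_le_compat_r => //.
exact: Rle_trans (Rle_abs _) (le_bigRmax (fun i => Rabs (M i)) i).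
Qed.

Lemma generated_ext {ZC : CompleteNormedModule K} (G G' : ZC -> ZC -> Prop) :
  (forall p q, G p q <-> G' p q) -> generated G -> generated G'.
Proof.
move=> GG [S [M [w [HS SG]]]]; exists S, M, w; split=> // x y.
by rewrite -GG.
Qed.

Local Notation Z := (prod_complete VC XC).
Local Notation ZN := (CompleteNormedModule.NormedModule K (prod_complete VC XC)).

(** The part [P2] is added first, by similarity. Any generator may then receive the bounded part
    [P1], so the two perturbations need no compatibility. *)
Lemma coupled_generated (Q : XN -> XN) :
  generated (ZC := Z) (@phase_graph k XC VC D J) -> splits VC XC J Q ->
  generated (ZC := Z) (@phase_graph k XC VC (Operator (dom D) (fun u => plus (D u) (Q u))) J).
Proof.
move=> G0 [P1 [P2 [HP1 [[Ha [Hs [M HM]]] HQ]]]].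
have HJ := fprod_map_linear.
have [a [a0 HJa]] := linear_norm _ HJ.
pose Q2 (p : ZN) : ZN := ((zero : VN), P2 (J p.1)).
pose Q1 (p : ZN) : ZN := ((zero : VN), P1 p.1).
have HQ1 : is_linear Q1.
  exact: (is_linear_comp (U := ZN) (W := ZN) _ _ (is_linear_comp _ _ is_linear_fst HP1) is_linear_inr).
have emb0 v : @phase_graph k XC VC D J ((zero : VN), J v) (v, (zero : XN)).
  by have [S [m [w [HS SG]]]] := G0; apply: (phase_emb D J S m w HS SG v).
have G2 : generated (ZC := Z) (perturbed (ZC := Z) (@phase_graph k XC VC D J) Q2).
  (* If [P2 (J x.1) = J v], then [(0, J v)] and its image [(v, 0)] have norms at most
     [2 * a * norm v] and [2 * norm v], whence [2 * (a + 1)]. The last [a + 1] bounds the graph norm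
     of [J x.1] by that of the phase operator. *)
  apply: (domain_perturbation (ZC := Z) _ Q2 (2 * (a + 1) * Rabs M * (a + 1))) => //.
  - move=> x y x' y' [_ [dx _]] [_ [dx' _]]; rewrite /Q2.
    have -> : J (plus x x').1 = plus (J x.1) (J x'.1) by apply: (linear_plus J HJ).
    rewrite Ha //; change (((zero : VN), plus (P2 (J x.1)) (P2 (J x'.1))) =
      (plus (zero : VN) zero, plus (P2 (J x.1)) (P2 (J x'.1)))).
    by rewrite plus_zero_r.
  - move=> c x y [_ [dx _]]; rewrite /Q2.
    have -> : J (scal c x).1 = scal c (J x.1) by apply: (linear_scal J HJ).
    rewrite Hs //; change (((zero : VN), scal c (P2 (J x.1))) =
      (scal c (zero : VN), scal c (P2 (J x.1)))).
    by rewrite scal_zero_r.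
  - move=> x y [_ [dx Dx]]; have [v [jv nv]] := HM _ dx.
    exists (v, (zero : XN)); rewrite /Q2 -jv; split; first exact: emb0.
    have nM := Rabs_pos M.
    have nx1 : norm (J x.1) <= (a + 1) * norm x.
      have h1 := HJa x.1; have h2 : norm x.1 <= norm x := norm_le_prod_norm_1 x.
      have h3 := Rmult_le_compat_l a _ _ ltac:(rlra) h2; have := norm_ge_0 x; rlra.
    have ny : norm (D (J x.1)) <= (a + 1) * norm y.
      have h2 : norm y.2 <= norm y := norm_le_prod_norm_2 y.
      by rewrite Dx; have := norm_ge_0 y; rnra.
    have h1 : norm ((zero : VN), J v) <= 2 * norm (J v) := norm_inr (J v).
    have h2 : norm (v, (zero : XN)) <= 2 * norm v := norm_inl v.
    have h3 := HJa v.
    have h4 : norm v <= Rabs M * ((a + 1) * (norm x + norm y)).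
      apply: Rle_trans nv _.
      apply: Rle_trans (Rmult_le_compat_r _ _ _ _ (Rle_abs M)) _.
        by apply: Rplus_le_le_0_compat; apply: norm_ge_0.
      apply: Rmult_le_compat_l => //; rewrite Rmult_plus_distr_l.
      exact: Rplus_le_compat nx1 ny.
    apply: Rle_trans (_ : 2 * (a + 1) * norm v <= _).
      by apply: Rle_trans (Rplus_le_compat _ _ _ _ h1 h2) _; rlra.
    have := Rmult_le_compat_l (2 * (a + 1)) _ _ ltac:(rlra) h4; rlra.
apply: generated_ext (bounded_perturbation (ZC := Z) _ Q1 G2 HQ1) => p q.
have e v x : dom D (J v) -> D (J v) = x ->
    plus (plus x (P2 (J v))) (P1 v) = plus (D (J v)) (Q (J v)).
  by move=> dv <-; rewrite HQ //; vec XN.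
split.
  move=> [z [[y [[e1 [d1 Dy]] ->]] ->]]; split; last split=> //.
    by change (J (plus (plus y.1 zero) zero) = p.2); rewrite !plus_zero_r.
  by rewrite /= -(e _ _ d1 Dy).
move=> [e1 [d1 /= e2]].
exists (q.1, plus (D (J p.1)) (P2 (J p.1))); split.
  exists (q.1, D (J p.1)); split; first by split.
  change ((q.1, plus (D (J p.1)) (P2 (J p.1))) =
    (plus q.1 (zero : VN), plus (D (J p.1)) (P2 (J p.1)))).
  by rewrite plus_zero_r.
change (q = (plus q.1 (zero : VN), plus (plus (D (J p.1)) (P2 (J p.1))) (P1 p.1))).
by rewrite plus_zero_r (e _ _ d1 erefl) e2; case: (q).
Qed.

End Coupling.

Theorem theorem4p1 (k : scalars) (n : nat)
  (X V : 'I_n -> CompleteNormedModule (field_of k))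
  (j : forall i, V i -> X i)
  (A : forall i, operator (X i))
  (hA : forall i, generates_COF_with_phase_space (A i) (j i))
  (B C : forall i l : 'I_n, X l -> X i)
  (hB : forall h l : 'I_n, (h < l)%N ->
     bounded_from_domain (A l) (j h) (B h l) \/
     is_linear (fun v : V l => B h l (j l v)))
  (hC : forall h l : 'I_n, (h < l)%N ->
     bounded_from_domain (A h) (j l) (C l h) \/
     is_linear (fun v : V h => C l h (j h v))) :
  generates_COF_with_phase_space (coupled_operator A B C) (fprod_map j).
Proof.
have Hj i : is_linear (j i) by have [_ [[]]] := hA i.
have inj i : injective (j i) by have [_ [[]]] := hA i.
have Aj i x : dom (A i) x -> exists v, j i v = x.
  by have [_ [_ [[_ [_ [M HM]]] _]]] := hA i; move/HM => [v [jv _]]; exists v.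
have HG : generated (ZC := prod_complete (fprod_CompleteNormedModule V) (fprod_CompleteNormedModule X))
    (phase_graph (diagonal X A) (fprod_map j)).
  apply: C0_generated; apply: (diagonal_generates V X j A) => i.
  by have [_ [_ [_ H]]] := hA i.
(* The two triangular sums are grouped into a single perturbation of the diagonal; [plus_assoc]
   matches this with [coupled_operator] at the end. *)
pose Q i (u : fprod_CompleteNormedModule X) : X i :=
  plus (\big[plus/zero]_(l < n | (i < l)%N) B i l (u l))
       (\big[plus/zero]_(h < n | (h < i)%N) C i h (u h)).
have HQ i : splits V X j A (V i) (X i) (j i) (Q i).
  apply: splits_plus => //; apply: splits_sum => // l il; apply: splits_entry => //.
    exact: hB.
  exact: hC.
have H := coupled_generated V X j A Hj _ HG (splits_fprod V X j A _ HQ).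
apply: phase_generation.
- split; first exact: fprod_map_linear.
  move=> v v' e; apply: functional_extensionality_dep => i; apply: (inj i).
  exact: (f_equal (fun u : fprod X => u i) e).
- move=> u Hu; have [v Hv] := dependent_choice _ (fun i => Aj i _ (Hu i)).
  by exists v; apply: functional_extensionality_dep.
apply: generated_ext H => p q; rewrite /phase_graph /graph /=.
have -> : plus (diagonal X A (fprod_map j p.1)) (fun i => Q i (fprod_map j p.1)) =
    coupled_operator A B C (fprod_map j p.1).
  by apply: functional_extensionality_dep => i; apply: plus_assoc.
by [].
Qed.
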